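(* Let $e\ge 1$ be an integer with $e\equiv 3$, $6$ or $7\pmod 8$. Then for all integers $n,w$ with $1\le w\le n-1$ there is no nontrivial $e$-perfect code in the Johnson scheme $J(n,w)$.
   Context: The Johnson scheme $J(n,w)$ has as elements all $w$-subsets of $[n]=\{1,\dots,n\}$, with distance $d(X,Y)=|X\setminus Y|$. The $e$-ball centred at $X$ is the set of $w$-subsets at distance at most $e$ from $X$. An $e$-perfect code in $J(n,w)$ is a set $\mathcal C$ of $w$-subsets such that the $e$-balls centred at the elements of $\mathcal C$ partition the set of all $w$-subsets of $[n]$. It is trivial if $e=0$, or $|\mathcal C|=1$, or $n=2w$, $w=2e+1$ and $\mathcal C$ consists of a $w$-subset and its complement; otherwise it is nontrivial. *)

(* Defs.v *)
From mathcomp Require Import all_boot.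

Set Implicit Arguments.
Unset Strict Implicit.
Unset Printing Implicit Defensive.

(* The ground set [n] = {1, ..., n} is represented by 'I_n = {0, ..., n - 1}. *)
Definition johnson (n w : nat) : {set {set 'I_n}} :=
  [set X : {set 'I_n} | #|X| == w].

Definition johnson_dist (n : nat) (X Y : {set 'I_n}) : nat := #|X :\: Y|.

Definition johnson_ball (n w e : nat) (X : {set 'I_n}) : {set {set 'I_n}} :=
  [set Y in johnson n w | johnson_dist X Y <= e].

(* The balls are required to partition J(n, w) as a family indexed by C.
   Using [partition] on the image set of balls would be wrong: distinct centres
   with equal balls (as happens for w <= e) would be identified. *)
Definition perfect_code (n w e : nat) (C : {set {set 'I_n}}) : Prop :=
  [/\ C \subset johnson n w,
      {in C &, forall X Y : {set 'I_n}, X != Y ->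
         [disjoint johnson_ball w e X & johnson_ball w e Y]}
    & \bigcup_(X in C) johnson_ball w e X = johnson n w].

Definition trivial_code (n w e : nat) (C : {set {set 'I_n}}) : Prop :=
  [\/ e = 0,
      #|C| = 1
    | [/\ n = 2 * w, w = 2 * e + 1
        & exists2 X : {set 'I_n}, X \in johnson n w & C = [set X; ~: X]]].

(* Main.v *)
Require Import Defs.
From mathcomp Require Import all_boot all_order all_algebra.
From mathcomp Require Import zify ring.

(** Write w' = n - w and let e be one of the listed residues. Passing to
    complements, assume w <= w'. Suppose that a perfect code C has two distinct
    codewords. The idea is to compute a power of 2 dividing the size Phi of a
    ball, and to find a set of codewords whose number is a binomial coefficient
    divided by Phi, where the binomial coefficient is less divisible by 2.

    Local structure. Fix X in C and describe a codeword Z by the pair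
    (X \ Z, Z \ X), two sets of size d(X, Z). Distinct codewords are at distance
    at least 2e + 1, and looking at the w-sets at distance e + 1 from X shows
    that the codewords at distance 2e + 1 cover every pair (I, J) of
    (e+1)-subsets of X and of its complement exactly once
    ([cover_unique]). So there are Steiner systems S(e+1, 2e+1, w) and
    S(e+1, 2e+1, w'). Counting blocks gives w = e + (e+1) a and
    w' = e + (e+1) b with a(a-1) and b(b-1) divisible by e + 2. Looking at the
    w-sets at distance e + 2 instead shows that each (I, J) is covered by the
    same number M = (a-1)(b-1) - e(a+b-2) of codewords at distance 2e + 2
    ([pair_count]), and e + 2 divides Ma and Mb. Finally e b < (e+1) a, because
    certain blocks are disjoint outside a common part ([packing]). As M >= 0,
    either a = b = 1, which is the case of a set and its complement, or
    a >= 2e + 1, so that w exceeds 2 (e+1)^2 - 2 ([size_dichotomy]).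

    The prime 2. For e = 3 mod 4 we have w = w' = 3 mod 4; for e = 6 mod 8 the
    divisibility by e + 2 leaves a, b in {0, 1} modulo 8, and the divisibility of
    Ma and Mb excludes a <> b, so w = w' = 5 or w = w' = 6 modulo 8. In all three
    cases 4 divides Phi, the sum of the C(w, d) C(w', d) for d <= e
    ([dvd4_ball_size]), since C(2N, 2k) = C(N, k) modulo 4 and similar relations
    make the terms cancel in blocks.

    Strength. The function Phi 1_C - 1 sums to 0 over each ball. Such a function
    also sums to 0 over the w-sets containing a given m-set, for all m <= t,
    provided that the eigenvalues of the ball on the first t harmonic spaces do
    not vanish ([ball_null_star]). These eigenvalues are alternating sums of
    products of binomial coefficients, and they are positive for m up to about
    w/2 because w is large compared with e^2 ([lloyd_pos]). Hence
    Phi #{Z in C : I included in Z} = C(n - t, w - t) for |I| = t <= w/2.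

    Conclusion. Let 2^L be the largest power of 2 with 2^L <= w and take
    t = w - 2^L. Then 4 divides Phi, hence C(2^L + w', 2^L). But w' < 3 * 2^L by
    the bound relating a and b, so that 2^L + w' has quotient 2 or 3 by 2^L and
    C(2^L + w', 2^L) is not a multiple of 4 ([bin_pow2_ndvd4]). *)

Set Implicit Arguments.
Unset Strict Implicit.
Unset Printing Implicit Defensive.
Import Order.TTheory GRing.Theory Num.Theory.

(** * Binomial coefficients modulo 4 *)

(** These relations are the coefficients of
    (1 + x)^(2N) = ((1 + x^2) + 2x)^N = (1 + x^2)^N + 2N x (1 + x^2)^(N-1) mod 4. *)
Lemma bin_double_mod4 N k :
  ('C(2 * N, 2 * k) = 'C(N, k) %[mod 4]) /\
  ('C(2 * N, (2 * k).+1) = 2 * k.+1 * 'C(N, k.+1) %[mod 4]).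
Proof.
elim: N k => [|N IH] k.
  by case: k => [|k]; rewrite ?muln0 ?mulnS ?bin0n //= bin0n muln0.
have -> : 2 * N.+1 = (2 * N).+2 by lia.
case: k => [|k].
  have [_ H1] := IH 0; rewrite muln0 in H1.
  split; first by rewrite muln0 !bin0.
  by rewrite muln0 !bin1; lia.
have -> : 2 * k.+1 = (2 * k).+2 by lia.
have [H0 H1] := IH k; have [H2 H3] := IH k.+1; have [H4 H5] := IH k.+2.
rewrite (_ : 2 * k.+1 = (2 * k).+2) in H2 H3; last by lia.
rewrite (_ : 2 * k.+2 = (2 * k).+4) in H4 H5; last by lia.
split; rewrite !binS; first lia.
have E : 2 * k.+2 * ('C(N, k.+2) + 'C(N, k.+1)) =
  2 * k.+2 * 'C(N, k.+2) + 2 * 'C(N, k.+1) + 2 * k.+1 * 'C(N, k.+1) by lia.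
rewrite E; lia.
Qed.

(** Halving N preserves C(N, 2^L) up to a unit modulo 4, so this comes down to
    C(Q, 1) = Q with Q the quotient of N by 2^L, which is 1, 2 or 3. *)
Lemma bin_pow2_ndvd4 L N : 2 ^ L <= N < 2 ^ L.+2 -> ~~ (4 %| 'C(N, 2 ^ L)).
Proof.
elim: L N => [|L IH] N /andP[lo hi].
  by rewrite expn0 bin1; rewrite expn0 in lo; move: hi; rewrite !expnS expn0; lia.
have Hh : 2 ^ L <= N./2 < 2 ^ L.+2.
  by move: lo hi; rewrite !expnS; lia.
have [E _] := bin_double_mod4 N./2 (2 ^ L).
have {IH} := IH _ Hh; rewrite /dvdn => IH.
case: (boolP (odd N)) => oN; last first.
  have EN : N = 2 * N./2 by lia.
  by rewrite EN expnS E.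
have EN : N = (2 * N./2).+1 by lia.
have [k Ek] : exists k, 2 ^ L = k.+1 by exists (2 ^ L).-1; rewrite prednK // expn_gt0.
have [_ E1] := bin_double_mod4 N./2 k.
rewrite EN expnS; rewrite Ek in E IH *.
have E2 : 2 * k.+1 = (2 * k).+2 by lia.
rewrite E2 binS; rewrite E2 in E.
suff : ('C(2 * N./2, (2 * k).+2) + 'C(2 * N./2, (2 * k).+1)) = (1 + 2 * k.+1) * 'C(N./2, k.+1) %[mod 4].
  move=> ->; rewrite -/(dvdn _ _) Gauss_dvdr //.
  by rewrite (coprimeXl 2 (m := 2)) // coprime2n /=; lia.
by rewrite mulnDl mul1n; lia.
Qed.

Definition ball_size (w w' e : nat) := \sum_(0 <= d < e.+1) 'C(w, d) * 'C(w', d).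

(** Applying [bin_double_mod4] to 2N with N odd, the middle binomial coefficients
    become those of 2N - 2; the pair (C(2W+1, k), C(2W, k)) is what survives in every
    case below. *)
Lemma bin_4W2_mod4 W k :
  ('C(4 * W + 2, 2 * k) = 'C(2 * W + 1, k) %[mod 4]) /\
  ('C(4 * W + 2, (2 * k).+1) = 2 * 'C(2 * W, k) %[mod 4]).
Proof.
have -> : 4 * W + 2 = 2 * (2 * W + 1) by lia.
have [-> ->] := bin_double_mod4 (2 * W + 1) k; split=> //.
have := mul_bin_diag (2 * W + 1) k; rewrite addn1 /= => E.
rewrite -mulnA -E -modnMm; lia.
Qed.

Lemma bin_4W3_mod4 W k :
  ('C(4 * W + 3, (2 * k).+1) = 'C(2 * W + 1, k) + 2 * 'C(2 * W, k) %[mod 4]) /\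
  ('C(4 * W + 3, (2 * k).+2) = 'C(2 * W + 1, k.+1) + 2 * 'C(2 * W, k) %[mod 4]).
Proof.
have -> : 4 * W + 3 = (4 * W + 2).+1 by lia.
have [E1 E2] := bin_4W2_mod4 W k; have [E3 _] := bin_4W2_mod4 W k.+1.
rewrite (_ : 2 * k.+1 = (2 * k).+2) in E3; last by lia.
by rewrite !binS; split; lia.
Qed.

Lemma bin_8W4_mod4 W k :
  [/\ 'C(8 * W + 4, 4 * k) = 'C(2 * W + 1, k) %[mod 4],
      'C(8 * W + 4, (4 * k).+2) = 2 * 'C(2 * W, k) %[mod 4] &
      'C(8 * W + 4, (2 * k).+1) = 0 %[mod 4]].
Proof.
have -> : 8 * W + 4 = 2 * (4 * W + 2) by lia.
have -> : 4 * k = 2 * (2 * k) by lia.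
have -> : (2 * (2 * k)).+2 = 2 * (2 * k).+1 by lia.
have [E1 E2] := bin_4W2_mod4 W k.
have [-> _] := bin_double_mod4 (4 * W + 2) (2 * k).
have [-> _] := bin_double_mod4 (4 * W + 2) (2 * k).+1.
have [_ ->] := bin_double_mod4 (4 * W + 2) k.
split => //.
rewrite -mulnA -mul_bin_diag.
have -> : 2 * ((4 * W + 2) * 'C((4 * W + 2).-1, k)) = ((2 * W + 1) * 'C((4 * W + 2).-1, k)) * 4 by lia.
by rewrite modnMl.
Qed.

(** A binomial coefficient of an even number at an odd place is even, so Pascal's
    rule identifies the entries of row 2W + 1 two by two modulo 2. *)
Lemma bin_odd_pair W l : 'C(2 * W + 1, (2 * l).+1) = 'C(2 * W + 1, 2 * l) %[mod 2].
Proof.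
have [_ E] := bin_double_mod4 W l.
rewrite addn1; case: l E => [|l] E; rewrite ?muln0 ?bin1 ?bin0; first by lia.
have [_ E'] := bin_double_mod4 W l.
rewrite (_ : 2 * l.+1 = (2 * l).+2); last by lia.
rewrite (_ : 2 * l.+1 = (2 * l).+2) in E; last by lia.
rewrite !binS; lia.
Qed.

Lemma eqn_modM a b c d m : a = b %[mod m] -> c = d %[mod m] -> a * c = b * d %[mod m].
Proof. by move=> E1 E2; rewrite -modnMm E1 E2 modnMm. Qed.

Lemma bin_odd_pair_prod W W' l :
  2 %| 'C(2 * W + 1, 2 * l) * 'C(2 * W' + 1, 2 * l) +
       'C(2 * W + 1, (2 * l).+1) * 'C(2 * W' + 1, (2 * l).+1).
Proof.
have := eqn_modM (bin_odd_pair W l) (bin_odd_pair W' l); lia.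
Qed.

Lemma bin_double_S W k : 'C(2 * W + 1, k.+1) = 'C(2 * W, k.+1) + 'C(2 * W, k).
Proof. by rewrite addn1 binS. Qed.

(** The common cancellation. When U = V + Z and U' = V' + Z', the cross terms
    2 U (V' + Z') + 2 U' (V + Z) add up to 4 U U', so only 2 U U' remains modulo 4. *)
Lemma prod_shift_mod4 (U U' V V' Z Z' : nat) :
  U = V + Z -> U' = V' + Z' ->
  (U + 2 * V) * (U' + 2 * V') + (U + 2 * Z) * (U' + 2 * Z') = 2 * (U * U') %[mod 4].
Proof.
move=> E E'.
have -> : (U + 2 * V) * (U' + 2 * V') + (U + 2 * Z) * (U' + 2 * Z') =
  (U * U' + V * V' + Z * Z') * 4 + 2 * (U * U').
  by rewrite E E'; lia.
by rewrite modnMDl.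
Qed.

(** The factor 2 turns the sum over two consecutive blocks into a matter of parity,
    which [bin_odd_pair_prod] settles. *)
Lemma block_sum_4W3 W W' k :
  'C(4 * W + 3, 2 * k) * 'C(4 * W' + 3, 2 * k) +
  'C(4 * W + 3, (2 * k).+1) * 'C(4 * W' + 3, (2 * k).+1) =
  2 * ('C(2 * W + 1, k) * 'C(2 * W' + 1, k)) %[mod 4].
Proof.
case: k => [|k]; first by rewrite muln0 !bin0 !bin1; lia.
have [H1 _] := bin_4W3_mod4 W k.+1; have [H1' _] := bin_4W3_mod4 W' k.+1.
have [_ H2] := bin_4W3_mod4 W k; have [_ H2'] := bin_4W3_mod4 W' k.
rewrite (_ : 2 * k.+1 = (2 * k).+2) in H1 H1' *; last by lia.
rewrite -modnDm (eqn_modM H1 H1') (eqn_modM H2 H2') modnDm.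
rewrite addnC.
exact: prod_shift_mod4 (bin_double_S _ _) (bin_double_S _ _).
Qed.

Lemma dvd4_ball_size3 W W' f : 4 %| ball_size (4 * W + 3) (4 * W' + 3) (4 * f + 3).
Proof.
rewrite /ball_size (_ : (4 * f + 3).+1 = 4 * f.+1); last by lia.
elim: f.+1 => [|g IH]; first by rewrite muln0 big_geq.
rewrite (_ : 4 * g.+1 = (4 * g).+4); last by lia.
rewrite !big_nat_recr //=.
have B1 := block_sum_4W3 W W' (2 * g); have B2 := block_sum_4W3 W W' (2 * g).+1.
rewrite (_ : 2 * (2 * g) = 4 * g) in B1; last by lia.
rewrite (_ : 2 * (2 * g).+1 = (4 * g).+2) in B2; last by lia.
have P := bin_odd_pair_prod W W' g.
lia.
Qed.

Lemma block_sum_8W5 W W' k :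
  'C(8 * W + 5, 4 * k) * 'C(8 * W' + 5, 4 * k) +
  'C(8 * W + 5, (4 * k).+1) * 'C(8 * W' + 5, (4 * k).+1) +
  'C(8 * W + 5, (4 * k).+2) * 'C(8 * W' + 5, (4 * k).+2) =
  2 * ('C(2 * W + 1, k) * 'C(2 * W' + 1, k)) %[mod 4] /\
  'C(8 * W + 5, (4 * k).+3) * 'C(8 * W' + 5, (4 * k).+3) = 0 %[mod 4].
Proof.
have F V : [/\ 'C(8 * V + 5, 4 * k) = 'C(2 * V + 1, k) %[mod 4],
  'C(8 * V + 5, (4 * k).+1) = 'C(2 * V + 1, k) %[mod 4],
  'C(8 * V + 5, (4 * k).+2) = 2 * 'C(2 * V, k) %[mod 4] &
  'C(8 * V + 5, (4 * k).+3) = 2 * 'C(2 * V, k) %[mod 4]].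
  rewrite (_ : 8 * V + 5 = (8 * V + 4).+1); last by lia.
  have [E1 E2 _] := bin_8W4_mod4 V k; have [_ _ E3] := bin_8W4_mod4 V (2 * k).
  have [_ _ E4] := bin_8W4_mod4 V (2 * k).+1.
  rewrite (_ : 2 * (2 * k) = 4 * k) in E3; last by lia.
  rewrite (_ : 2 * (2 * k).+1 = (4 * k).+2) in E4; last by lia.
  split; rewrite ?binS; try lia.
  case: k E1 {E2 E3 E4} => [|k] E1; first by rewrite muln0 !bin0.
  have [_ _ E5] := bin_8W4_mod4 V (2 * k).+1.
  rewrite (_ : 4 * k.+1 = (4 * k).+4) in E1 *; last by lia.
  rewrite (_ : (2 * (2 * k).+1).+1 = (4 * k).+3) in E5; last by lia.
  by rewrite binS; lia.
have [A1 A2 A3 A4] := F W; have [A1' A2' A3' A4'] := F W'.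
have := eqn_modM A1 A1'; have := eqn_modM A2 A2'; have := eqn_modM A3 A3'; have := eqn_modM A4 A4'.
have -> : 2 * 'C(2 * W, k) * (2 * 'C(2 * W', k)) = 'C(2 * W, k) * 'C(2 * W', k) * 4 by lia.
by rewrite modnMl; lia.
Qed.

Lemma block_sum_8W6 W W' k :
  'C(8 * W + 6, 4 * k) * 'C(8 * W' + 6, 4 * k) +
  'C(8 * W + 6, (4 * k).+1) * 'C(8 * W' + 6, (4 * k).+1) +
  'C(8 * W + 6, (4 * k).+2) * 'C(8 * W' + 6, (4 * k).+2) =
  2 * ('C(2 * W + 1, k) * 'C(2 * W' + 1, k)) %[mod 4] /\
  'C(8 * W + 6, (4 * k).+3) * 'C(8 * W' + 6, (4 * k).+3) = 0 %[mod 4].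
Proof.
have F V : [/\ 'C(8 * V + 6, (4 * k).+1) = 2 * 'C(2 * V + 1, k) %[mod 4],
  'C(8 * V + 6, (4 * k).+2) = 'C(2 * V + 1, k) + 2 * 'C(2 * V, k) %[mod 4] &
  'C(8 * V + 6, (4 * k).+3) = 0 %[mod 4]].
  rewrite (_ : 8 * V + 6 = (8 * V + 4).+2); last by lia.
  have [E1 E2 _] := bin_8W4_mod4 V k; have [_ _ E3] := bin_8W4_mod4 V (2 * k).
  have [_ _ E4] := bin_8W4_mod4 V (2 * k).+1.
  rewrite (_ : 2 * (2 * k) = 4 * k) in E3; last by lia.
  rewrite (_ : 2 * (2 * k).+1 = (4 * k).+2) in E4; last by lia.
  split; try by rewrite !binS; lia.
  rewrite binS; case: k E1 {E2 E4} E3 => [|k] E1 E3; first by rewrite !muln0 !bin0 !bin1; lia.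
  have [_ _ E5] := bin_8W4_mod4 V (2 * k).+1.
  rewrite (_ : 4 * k.+1 = (4 * k).+4) in E1 E3 *; last by lia.
  rewrite (_ : (2 * (2 * k).+1).+1 = (4 * k).+3) in E5; last by lia.
  by rewrite !binS; lia.
have [A1 A2 A3] := F W; have [A1' A2' A3'] := F W'.
have := eqn_modM A1 A1'; have := eqn_modM A2 A2'; have := eqn_modM A3 A3'.
rewrite mulnACA => -> B2 B1; split=> //.
rewrite addnAC -modnDm B1.
have -> : (2 * 2 * ('C(2 * W + 1, k) * 'C(2 * W' + 1, k))) %% 4 = 0 by rewrite modnMr.
rewrite addn0 modn_mod -modnDmr B2 modnDmr {A1 A2 A3 A1' A2' A3' B1 B2 F}.
case: k => [|k]; first by rewrite muln0 !bin0.
have G V : 'C(8 * V + 6, 4 * k.+1) = 'C(2 * V + 1, k.+1) + 2 * 'C(2 * V, k) %[mod 4].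
  rewrite (_ : 8 * V + 6 = (8 * V + 4).+2); last by lia.
  have [_ E2 _] := bin_8W4_mod4 V k; have [E1 _ _] := bin_8W4_mod4 V k.+1.
  have [_ _ E5] := bin_8W4_mod4 V (2 * k).+1.
  rewrite (_ : 4 * k.+1 = (4 * k).+4) in E1 *; last by lia.
  rewrite (_ : (2 * (2 * k).+1).+1 = (4 * k).+3) in E5; last by lia.
  by rewrite !binS; lia.
rewrite -modnDml (eqn_modM (G W) (G W')) modnDml addnC.
exact: prod_shift_mod4 (bin_double_S _ _) (bin_double_S _ _).
Qed.

(** Rows congruent to 5 and to 6 modulo 8 both give products D that are grouped in the same
    way by four, the fourth product being 0 modulo 4. This is why a sum stopped at
    8f + 6 is as good as one stopped at the end of a block of eight. *)
Lemma dvd4_sum8 (D U : nat -> nat) f :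
  (forall k, D (4 * k) + D (4 * k).+1 + D (4 * k).+2 = 2 * U k %[mod 4] /\ D (4 * k).+3 = 0 %[mod 4]) ->
  (forall l, 2 %| U (2 * l) + U (2 * l).+1) ->
  4 %| \sum_(0 <= d < 8 * f + 7) D d.
Proof.
move=> HD HU.
have H8 g : 4 %| \sum_(0 <= d < 8 * g) D d.
  elim: g => [|g IH]; first by rewrite muln0 big_geq.
  rewrite (_ : 8 * g.+1 = (8 * g).+4.+4); last by lia.
  rewrite !big_nat_recr //=.
  have [B1 B2] := HD (2 * g); have [B3 B4] := HD (2 * g).+1.
  rewrite (_ : 4 * (2 * g) = 8 * g) in B1 B2; last by lia.
  rewrite (_ : 4 * (2 * g).+1 = (8 * g).+4) in B3 B4; last by lia.
  have P := HU g; lia.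
have := H8 f.+1; rewrite (_ : 8 * f.+1 = (8 * f + 7).+1) ?big_nat_recr //=; last by lia.
have [_] := HD (2 * f).+1; rewrite (_ : (4 * (2 * f).+1).+3 = 8 * f + 7); last by lia.
lia.
Qed.

Lemma dvd4_ball_size5 W W' f : 4 %| ball_size (8 * W + 5) (8 * W' + 5) (8 * f + 6).
Proof.
rewrite /ball_size (_ : (8 * f + 6).+1 = 8 * f + 7); last by lia.
exact: dvd4_sum8 (block_sum_8W5 W W') (bin_odd_pair_prod W W').
Qed.

Lemma dvd4_ball_size6 W W' f : 4 %| ball_size (8 * W + 6) (8 * W' + 6) (8 * f + 6).
Proof.
rewrite /ball_size (_ : (8 * f + 6).+1 = 8 * f + 7); last by lia.
exact: dvd4_sum8 (block_sum_8W6 W W') (bin_odd_pair_prod W W').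
Qed.

(** * Counting in finite designs *)

Lemma sum_bool_card (T : finType) (A : {set T}) (P : pred T) :
  \sum_(x in A) (P x : nat) = #|[set x in A | P x]|.
Proof.
rewrite -sum1dep_card big_mkcondr /=.
by apply: eq_bigr => x _; case: (P x).
Qed.

Lemma double_count (S T : finType) (A : {set S}) (B : {set T}) (R : S -> T -> bool) :
  \sum_(x in A) #|[set y in B | R x y]| = \sum_(y in B) #|[set x in A | R x y]|.
Proof.
under eq_bigr do rewrite -sum_bool_card.
by rewrite exchange_big /=; under eq_bigr do rewrite sum_bool_card.
Qed.

(** Hypergeometric counting: the two traces of a set can be chosen independently. *)
Lemma card_split (T : finType) (U V : {set T}) i j : [disjoint U & V] ->
  #|[set Y : {set T} | [&& Y \subset U :|: V, #|Y :&: U| == i & #|Y :&: V| == j]]| =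
  'C(#|U|, i) * 'C(#|V|, j).
Proof.
move=> dUV; rewrite -!cards_draws -cardsX.
set L := [set Y | _]; set D := setX _ _.
have parts (A B : {set T}) : A \subset U -> B \subset V ->
    (A :|: B) :&: U = A /\ (A :|: B) :&: V = B.
  move=> AU BV; rewrite !setIUl (setIidPl AU) (setIidPl BV); split.
    rewrite (disjoint_setI0 (_ : [disjoint B & U])) ?setU0 //.
    by rewrite disjoint_sym; apply: disjointWr BV _.
  rewrite (disjoint_setI0 (_ : [disjoint A & V])) ?set0U //.
  exact: disjointWl AU _.
rewrite -(@card_in_imset _ _ (fun AB : {set T} * {set T} => AB.1 :|: AB.2) D).
  apply: eq_card => Y; apply/idP/imsetP.
    rewrite inE => /and3P[YUV YU YV]; exists (Y :&: U, Y :&: V).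
      by rewrite !inE /= !subsetIr YU YV.
    by rewrite /= -setIUr (setIidPl YUV).
  case=> -[A B]; rewrite !inE /= => /andP[/andP[AU /eqP <-] /andP[BV /eqP <-]] ->.
  have [-> ->] := parts A B AU BV.
  by rewrite setUSS ?eqxx.
move=> [A B] [A' B']; rewrite !inE /= => /andP[/andP[AU _] /andP[BV _]].
move=> /andP[/andP[AU' _] /andP[BV' _]] E.
have [E1 E2] := parts A B AU BV; have [E3 E4] := parts A' B' AU' BV'.
by congr pair; [rewrite -E1 E E3 | rewrite -E2 E E4].
Qed.

Lemma card_between (T : finType) (J B : {set T}) s :
  J \subset B -> #|J| <= s ->
  #|[set K : {set T} | [&& J \subset K, K \subset B & #|K| == s]]| =
  'C(#|B| - #|J|, s - #|J|).
Proof.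
move=> JB Js; rewrite -(cardsDS JB).
rewrite -[RHS]mul1n -(binn #|J|) -card_split; last first.
  by rewrite -setI_eq0 setDE setICA setICr setI0.
apply: eq_card => K; rewrite !inE -{2}(setIidPr JB) setID.
rewrite andbCA; case KB: (K \subset B) => //=.
have -> : K :&: (B :\: J) = K :\: J by rewrite setIDA (setIidPl KB).
have -> : (#|K :&: J| == #|J|) = (J \subset K).
  apply/eqP/idP => [c|/setIidPr -> //]; apply/setIidPr/eqP.
  by rewrite eqEcard subsetIr c /=.
case JK: (J \subset K) => //=; rewrite cardsDS //.
by have := subset_leq_card JK; lia.
Qed.

(** Double counting of the pairs (K, z) with J included in K and K included in the block of
    z. Families are indexed because two codewords may have the same difference set with X. *)
Lemma design_count (I T : finType) (F : {set I}) (b : I -> {set T}) (V J : {set T}) k s mu :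
  (forall z, z \in F -> b z \subset V /\ #|b z| = k) ->
  (forall K : {set T}, K \subset V -> #|K| = s -> #|[set z in F | K \subset b z]| = mu) ->
  J \subset V -> #|J| <= s ->
  #|[set z in F | J \subset b z]| * 'C(k - #|J|, s - #|J|) = mu * 'C(#|V| - #|J|, s - #|J|).
Proof.
move=> Fb Fs JV Js; rewrite -(card_between JV Js).
set A := [set K : {set T} | _].
have := double_count A F (fun K z => K \subset b z).
rewrite (eq_bigr (fun=> mu)); last first.
  by move=> K; rewrite inE => /and3P[_ KV /eqP]; apply: Fs.
rewrite sum_nat_const mulnC => ->.
rewrite -sum_bool_card big_distrl /=; apply: eq_bigr => z zF.
have [bV bk] := Fb z zF.
case Jb: (J \subset b z); last first.
  rewrite mul0n; apply/esym/eqP; rewrite cards_eq0; apply/eqP/setP => K; rewrite !inE.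
  apply/negP => /andP[/and3P[JK _ _] Kb]; by rewrite (subset_trans JK Kb) in Jb.
rewrite mul1n -bk -card_between //; apply: eq_card => K; rewrite !inE.
case Kb: (K \subset b z); rewrite ?andbF // andbT /=.
by rewrite (subset_trans Kb bV).
Qed.

(** The blocks missing exactly one point of J contain J minus a point y. For each y
    the blocks through J minus y are counted by [design_count], and the only one to
    discard is the block through J. *)
Lemma defect_count (I T : finType) (F : {set I}) (b : I -> {set T}) (V J : {set T}) k s :
  (forall z, z \in F -> b z \subset V /\ #|b z| = k) ->
  (forall K : {set T}, K \subset V -> #|K| = s.+1 -> #|[set z in F | K \subset b z]| = 1) ->
  J \subset V -> #|J| = s.+1 ->
  #|[set z in F | #|J :\: b z| == 1]| * (k - s) + s.+1 * (k - s) = s.+1 * (#|V| - s).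
Proof.
move=> Fb Fs JV Js.
have E y : y \in J -> #|[set z in F | J :\ y \subset b z]| * (k - s) = #|V| - s.
  move=> yJ; have c : #|J :\ y| = s by have := cardsD1 y J; rewrite yJ Js; lia.
  have := design_count Fb Fs (subset_trans (subsetDl _ _) JV) (_ : #|J :\ y| <= s.+1).
  by rewrite c subSnn !bin1 mul1n => ->.
rewrite -mulnDl -[in RHS]Js -sum_nat_const -(eq_bigr _ E) -big_distrl /=; congr (_ * _).
rewrite (double_count J F (fun y z => J :\ y \subset b z)) addnC.
have -> : s.+1 = \sum_(z in F) s.+1 * (J \subset b z).
  by rewrite -big_distrr sum_bool_card /= (Fs J JV Js) muln1.
rewrite -sum_bool_card -big_split /=.
apply: eq_bigr => z _; have sub y : (J :\ y \subset b z) = (J :\: b z \subset [set y]).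
  by rewrite !subDset setUC.
rewrite -[RHS]sum_bool_card; under [RHS]eq_bigr => y _ do rewrite sub.
case: (ltngtP #|J :\: b z| 1) => c.
- have /eqP Jb : J :\: b z == set0 by rewrite -cards_eq0; lia.
  have -> : J \subset b z by rewrite -setD_eq0 Jb.
  rewrite Jb muln1 -Js -sum1_card addn0; apply: eq_bigr => y _.
  by rewrite sub0set.
- have -> : (J \subset b z) = false by rewrite -setD_eq0 -cards_eq0; lia.
  rewrite muln0 big1 // => y _; case H: (_ \subset _) => //.
  by have := subset_leq_card H; rewrite cards1 leqNgt c.
have -> : (J \subset b z) = false by rewrite -setD_eq0 -cards_eq0; lia.
rewrite muln0 add0n; have /cards1P[y0 E0] := introT eqP c.
rewrite sum_bool_card E0 (_ : [set _ in J | _] = [set y0]) ?cards1 //.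
apply/setP => y; rewrite !inE sub1set !inE eq_sym andbC; case: eqP => // ->.
by have /setDP[-> _] : y0 \in J :\: b z by rewrite E0 inE.
Qed.

(** * The neighbourhood of a codeword *)

Lemma sub_of_card (T : finType) (A : {set T}) k : k <= #|A| ->
  exists2 B : {set T}, B \subset A & #|B| = k.
Proof.
rewrite -bin_gt0 -cards_draws => /card_gt0P[B]; rewrite inE => /andP[BA /eqP cB].
by exists B.
Qed.

Lemma card1_eq (T : finType) (A : {set T}) x y : #|A| = 1 -> x \in A -> y \in A -> x = y.
Proof. by move=> /eqP/cards1P[z ->]; rewrite !inE => /eqP-> /eqP->. Qed.

(** Perfect codes, in the form used throughout: every w-set is within distance e of
    exactly one codeword. Complementation acts on this formulation more directly than
    on partitions into balls. The ground set is an arbitrary finite type. *)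
Definition tiles (T : finType) (w e : nat) (C : {set {set T}}) :=
  (forall X, X \in C -> #|X| = w) /\
  forall Y : {set T}, #|Y| = w -> #|[set Z in C | #|Y :\: Z| <= e]| = 1.

Lemma card_setD_sym (T : finType) (X Z : {set T}) : #|X| = #|Z| -> #|X :\: Z| = #|Z :\: X|.
Proof. by move=> E; rewrite !cardsD E setIC. Qed.

(** The w-set obtained from X by exchanging A with B gets closer to Z by one for each
    element of A outside Z and each element of B in Z. *)
Lemma swap_dist (T : finType) (X Z A B : {set T}) : A \subset X -> B \subset ~: X ->
  #|((X :\: A) :|: B) :\: Z| + #|A :&: (X :\: Z)| + #|B :&: (Z :\: X)| = #|X :\: Z| + #|B|.
Proof.
move=> AX BX.
have dXB : [disjoint X & B] by rewrite disjoints_subset subsetC.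
rewrite setDUl cardsU.
have -> : (X :\: A :\: Z) :&: (B :\: Z) = set0.
  apply/setP => x; rewrite !inE; case xB: (x \in B); rewrite ?andbF //.
  by rewrite (disjointFl dXB xB) !andbF.
have -> : B :&: (Z :\: X) = B :&: Z.
  apply/setP => x; rewrite !inE; case xB: (x \in B) => //=.
  by rewrite (disjointFl dXB xB).
have -> : X :\: A :\: Z = (X :\: Z) :\: A by rewrite !setDDl setUC.
have := cardsID A (X :\: Z); have := cardsID Z B.
rewrite cards0 [A :&: _]setIC; lia.
Qed.

Lemma swap_card (T : finType) (X A B : {set T}) : A \subset X -> B \subset ~: X ->
  #|A| = #|B| -> #|(X :\: A) :|: B| = #|X|.
Proof.
move=> AX BX E; rewrite cardsU (_ : _ :&: B = set0) ?cards0 ?subn0.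
  by rewrite cardsDS // -E subnK // subset_leq_card.
apply/setP => x; rewrite !inE; case xB: (x \in B); rewrite ?andbF //.
by have := subsetP BX x xB; rewrite inE => /negbTE->; rewrite andbF.
Qed.

Lemma card_add_defect (T : finType) (x : T) (K W : {set T}) : x \notin K ->
  #|(x |: K) :&: W| + #|K :\: W| = #|K| + (x \in W).
Proof.
move=> xK; rewrite -[#|K|](cardsID W K) setIUl cardsU.
have -> : ([set x] :&: W) :&: (K :&: W) = set0.
  by apply/setP => y; rewrite !inE; case: eqP => // ->; rewrite (negbTE xK) !andbF.
have -> : #|[set x] :&: W| = (x \in W).
  case xW: (x \in W); first by rewrite (setIidPl _) ?cards1 // sub1set.
  by apply/eqP; rewrite cards_eq0 setI_eq0 disjoints1 xW.
by rewrite cards0; lia.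
Qed.

(** A condition s <= [a in A] + [b in B] on pairs (a, b) of U * V means
    a in A or b in B if s = 1, a in A and b in B if s = 2, and is impossible for s > 2. *)
Lemma card_rect (T : finType) (U V A B : {set T}) s : 0 < s ->
  #|[set ab in setX U V | s <= (ab.1 \in A) + (ab.2 \in B)]| =
  if s == 1 then #|U| * #|V| - #|U :\: A| * #|V :\: B|
  else if s == 2 then #|U :&: A| * #|V :&: B| else 0.
Proof.
case: s => [//|[|[|s]]] _ /=.
- rewrite -!cardsX -cardsDS; last by apply/subsetP => -[a b]; rewrite !inE /= => /andP[/andP[_ ->] /andP[_ ->]].
  apply: eq_card => -[a b]; rewrite !inE /=.
  by case: (a \in U); case: (b \in V); case: (a \in A); case: (b \in B).
- rewrite -cardsX; apply: eq_card => -[a b]; rewrite !inE /=.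
  by case: (a \in U); case: (b \in V); case: (a \in A); case: (b \in B).
- apply/eqP; rewrite cards_eq0; apply/eqP/setP => -[a b]; rewrite !inE /=.
  by case: (a \in A); case: (b \in B); rewrite andbF.
Qed.

(** Case analysis behind [pair_count]. Here d is the distance from X to Z, x and y the
    numbers of elements of I and J not covered by Z, and al, be the numbers of elements
    of X \ Z and Z \ X outside I and J. A pair (a, b) is exchanged towards Z when
    d + x + y - 2e <= [a in X \ Z] + [b in Z \ X], which leaves four kinds of Z. *)
Lemma rect_cases e d x y al be P Q R : 2 * e < d ->
  al + e.+1 = d + x -> be + e.+1 = d + y ->
  (d = (2 * e).+1 -> x = 0 -> y = 0 -> R = Q) ->
  (if d + x + y - 2 * e == 1 then P - R else if d + x + y - 2 * e == 2 then al * be else 0) =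
  [&& d == (2 * e).+1, x == 0 & y == 0] * (P - Q) +
  [&& d == (2 * e).+1, x == 1 & y == 0] * (e * e.+1) +
  [&& d == (2 * e).+1, x == 0 & y == 1] * (e * e.+1) +
  [&& d == (2 * e).+2, x == 0 & y == 0] * (e.+1 * e.+1).
Proof.
move=> D Ea Eb ER.
have [k Ed] : exists k, d = (2 * e).+1 + k by exists (d - (2 * e).+1); lia.
have -> : d + x + y - 2 * e = (k + x + y).+1 by lia.
have -> : (d == (2 * e).+1) = (k == 0) by lia.
have -> : (d == (2 * e).+2) = (k == 1) by lia.
case: k Ed => [|[|k]] Ed; case: x Ea ER => [|[|x]] Ea ER; case: y Eb ER => [|[|y]] Eb ER;
  rewrite ?addn0 ?add0n ?addnS ?addSn ?eqSS /= ?mul0n ?mul1n ?addn0 ?add0n //.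
- by rewrite ER // Ed addn0.
- by have [-> ->] : al = e /\ be = e.+1; [lia | rewrite mulnC].
- by have [-> ->] : al = e.+1 /\ be = e; [lia | rewrite mulnC].
- by have [-> ->] : al = e.+1 /\ be = e.+1; [lia | ].
Qed.

Section Distance.
Variables (T : finType) (w e : nat) (C : {set {set T}}) (X : {set T}).
Hypothesis Ct : tiles w e C.
Hypothesis XC : X \in C.

Lemma card_code Z : Z \in C -> #|Z| = w.
Proof. exact: (proj1 Ct). Qed.

Lemma card_out Z : Z \in C -> #|Z :\: X| = #|X :\: Z|.
Proof. by move=> ZC; apply: card_setD_sym; rewrite !card_code. Qed.

(** The code property at the w-set X - A + B, rewritten with [swap_dist]. *)
Lemma near_unique (A B : {set T}) : A \subset X -> B \subset ~: X -> #|A| = #|B| ->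
  #|[set Z in C | #|X :\: Z| + #|B| <= e + #|A :&: (X :\: Z)| + #|B :&: (Z :\: X)|]| = 1.
Proof.
move=> AX BX E; rewrite -(proj2 Ct (X :\: A :|: B)) ?swap_card ?(card_code XC) //.
apply: eq_card => Z; rewrite !inE; congr (_ && _).
by have := swap_dist Z AX BX; lia.
Qed.

(** If d(X, Z) <= 2e, exchange min(e, d(X, Z)) elements of X towards Z: the result is
    within distance e of both X and Z. *)
Lemma mindist Z : Z \in C -> Z != X -> 2 * e < #|X :\: Z|.
Proof.
move=> ZC; apply: contraNT; rewrite -leqNgt => D.
have [A AX cA] := @sub_of_card _ (X :\: Z) (minn e #|X :\: Z|) (geq_minr _ _).
have [B BX cB] : exists2 B : {set T}, B \subset Z :\: X & #|B| = minn e #|X :\: Z|.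
  by apply: sub_of_card; rewrite card_out // geq_minr.
have BX' : B \subset ~: X by apply: subset_trans BX _; rewrite setDE subsetIr.
have AX' := subset_trans AX (subsetDl _ _).
apply/eqP/(card1_eq (near_unique AX' BX' (etrans cA (esym cB)))).
  by rewrite inE ZC (setIidPl AX) (setIidPl BX) cA cB; lia.
by rewrite inE XC setDv cards0 cB; lia.
Qed.

End Distance.

Section Local.
Variables (T : finType) (w w' e : nat) (C : {set {set T}}) (X : {set T}).
Hypothesis Tw : #|T| = w + w'.
Hypothesis Ct : tiles w e C.
Hypothesis XC : X \in C.

(** The codewords of the shell of radius 2e + 1, called blocks below, are the closest ones to
    X. Those with X \ Z containing a given (e+1)-set form a Steiner system through their
    sets Z \ X, and vice versa. *)
Definition shell d := [set Z in C | #|X :\: Z| == d].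

Lemma shell_in d Z : Z \in shell d -> [/\ Z \in C, #|X :\: Z| = d & #|Z :\: X| = d].
Proof. by rewrite inE => /andP[ZC /eqP d_]; split; rewrite ?(card_out Ct XC). Qed.

(** A w-set X - I + J at distance e + 1 from X is within distance e of a codeword Z
    different from X; by [mindist] and [swap_dist] this forces d(X, Z) = 2e + 1 and Z to
    cover both I and J. *)
Lemma cover_unique (I J : {set T}) : I \subset X -> J \subset ~: X -> #|I| = e.+1 -> #|J| = e.+1 ->
  #|[set Z in shell (2 * e).+1 | (I \subset X :\: Z) && (J \subset Z :\: X)]| = 1.
Proof.
move=> IX JX cI cJ; rewrite -[RHS](near_unique Ct XC IX JX) ?cI ?cJ //.
apply: eq_card => Z; rewrite !inE; case ZC: (Z \in C) => //=.
have hI := subset_leq_card (subsetIl I (X :\: Z)).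
have hJ := subset_leq_card (subsetIl J (Z :\: X)).
have hI' := subset_leq_card (subsetIr I (X :\: Z)).
have hJ' := subset_leq_card (subsetIr J (Z :\: X)).
have -> : (I \subset X :\: Z) = (#|I :&: (X :\: Z)| == e.+1).
  by rewrite -cI; apply/setIidPl/eqP => [-> //|c]; apply/eqP; rewrite eqEcard subsetIl c /=.
have -> : (J \subset Z :\: X) = (#|J :&: (Z :\: X)| == e.+1).
  by rewrite -cJ; apply/setIidPl/eqP => [-> //|c]; apply/eqP; rewrite eqEcard subsetIl c /=.
rewrite cI in hI; rewrite cJ in hJ.
have cO := card_out Ct XC ZC.
case: (eqVneq Z X) => [ZX|/(mindist Ct XC ZC) D]; last first.
  by lia.
have D0 : #|X :\: Z| = 0 by rewrite ZX setDv cards0.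
lia.
Qed.

Lemma card_X : #|X| = w. Proof. exact: card_code Ct _ XC. Qed.
Lemma card_Xc : #|~: X| = w'. Proof. by rewrite cardsCs setCK card_X Tw addKn. Qed.

Lemma shell_sub d Z : Z \in shell d ->
  (X :\: Z \subset X /\ #|X :\: Z| = d) /\ (Z :\: X \subset ~: X /\ #|Z :\: X| = d).
Proof.
by move=> /shell_in[_ -> ->]; rewrite subsetDl setDE subsetIr.
Qed.

Lemma cover_out (I J : {set T}) : I \subset X -> #|I| = e.+1 -> J \subset ~: X -> #|J| = e.+1 ->
  #|[set Z in [set Z in shell (2 * e).+1 | I \subset X :\: Z] | J \subset Z :\: X]| = 1.
Proof.
move=> IX cI JX cJ; rewrite -[RHS](cover_unique IX JX cI cJ); apply: eq_card => Z.
by rewrite !inE -!andbA.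
Qed.

Lemma cover_in (I J : {set T}) : J \subset ~: X -> #|J| = e.+1 -> I \subset X -> #|I| = e.+1 ->
  #|[set Z in [set Z in shell (2 * e).+1 | J \subset Z :\: X] | I \subset X :\: Z]| = 1.
Proof.
move=> JX cJ IX cI; rewrite -[RHS](cover_unique IX JX cI cJ); apply: eq_card => Z.
by rewrite !inE -!andbA [(I \subset _) && _]andbC.
Qed.

Hypotheses (ew : e < w) (ew' : e < w').

Lemma count_out (I J0 : {set T}) : I \subset X -> #|I| = e.+1 -> J0 \subset ~: X -> #|J0| <= e.+1 ->
  #|[set Z in [set Z in shell (2 * e).+1 | I \subset X :\: Z] | J0 \subset Z :\: X]| *
   'C((2 * e).+1 - #|J0|, e.+1 - #|J0|) = 'C(w' - #|J0|, e.+1 - #|J0|).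
Proof.
move=> IX cI JX cJ.
rewrite (@design_count _ _ _ (fun Z : {set T} => Z :\: X) (~: X) J0 _ _ 1) // ?mul1n ?card_Xc //.
  by move=> Z; rewrite inE => /andP[/shell_sub[]].
by move=> K KX cK; apply: cover_out.
Qed.

Lemma count_in (I0 J : {set T}) : J \subset ~: X -> #|J| = e.+1 -> I0 \subset X -> #|I0| <= e.+1 ->
  #|[set Z in [set Z in shell (2 * e).+1 | J \subset Z :\: X] | I0 \subset X :\: Z]| *
   'C((2 * e).+1 - #|I0|, e.+1 - #|I0|) = 'C(w - #|I0|, e.+1 - #|I0|).
Proof.
move=> JX cJ IX cI.
rewrite (@design_count _ _ _ (fun Z : {set T} => X :\: Z) X I0 _ _ 1) // ?mul1n ?card_X //.
  by move=> Z; rewrite inE => /andP[/shell_sub[]].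
by move=> K KX cK; apply: cover_in.
Qed.

Lemma shell_room : (2 * e).+1 <= w /\ (2 * e).+1 <= w'.
Proof.
have [I IX cI] : exists2 I : {set T}, I \subset X & #|I| = e.+1.
  by apply: sub_of_card; rewrite card_X.
have [J JX cJ] : exists2 J : {set T}, J \subset ~: X & #|J| = e.+1.
  by apply: sub_of_card; rewrite card_Xc.
have /card_gt0P[Z] : 0 < #|[set Z in shell (2 * e).+1 | (I \subset X :\: Z) && (J \subset Z :\: X)]|.
  by rewrite cover_unique.
rewrite inE => /andP[/shell_sub[[s1 c1] [s2 c2]] _].
by rewrite -{1}c1 -c2 -card_X -card_Xc !subset_leq_card.
Qed.

Lemma defect_out (I J : {set T}) : I \subset X -> #|I| = e.+1 -> J \subset ~: X -> #|J| = e.+1 ->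
  #|[set Z in shell (2 * e).+1 | (I \subset X :\: Z) && (#|J :\: (Z :\: X)| == 1)]| = w' - (2 * e).+1.
Proof.
move=> IX cI JX cJ; have [_ le2] := shell_room.
have := @defect_count _ _ [set Z in shell (2 * e).+1 | I \subset X :\: Z]
  (fun Z : {set T} => Z :\: X) (~: X) J (2 * e).+1 e _ _ JX cJ.
rewrite card_Xc.
have -> : [set Z in [set Z in shell (2 * e).+1 | I \subset X :\: Z] | #|J :\: (Z :\: X)| == 1]
  = [set Z in shell (2 * e).+1 | (I \subset X :\: Z) && (#|J :\: (Z :\: X)| == 1)].
  by apply/setP => Z; rewrite !inE -!andbA.
rewrite (_ : (2 * e).+1 - e = e.+1); last by lia.
move=> H.
have : e.+1 * (#|[set Z in shell (2 * e).+1 | (I \subset X :\: Z) && (#|J :\: (Z :\: X)| == 1)]| + e.+1)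
  = e.+1 * (w' - e).
  rewrite mulnDr mulnC; apply: H; first by move=> Z; rewrite inE => /andP[/shell_sub[]].
  by move=> K KX cK; apply: cover_out.
by move/eqP; rewrite eqn_pmul2l // => /eqP; lia.
Qed.

Lemma defect_in (I J : {set T}) : I \subset X -> #|I| = e.+1 -> J \subset ~: X -> #|J| = e.+1 ->
  #|[set Z in shell (2 * e).+1 | (#|I :\: (X :\: Z)| == 1) && (J \subset Z :\: X)]| = w - (2 * e).+1.
Proof.
move=> IX cI JX cJ; have [le2 _] := shell_room.
have := @defect_count _ _ [set Z in shell (2 * e).+1 | J \subset Z :\: X]
  (fun Z : {set T} => X :\: Z) X I (2 * e).+1 e _ _ IX cI.
rewrite card_X.
have -> : [set Z in [set Z in shell (2 * e).+1 | J \subset Z :\: X] | #|I :\: (X :\: Z)| == 1]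
  = [set Z in shell (2 * e).+1 | (#|I :\: (X :\: Z)| == 1) && (J \subset Z :\: X)].
  by apply/setP => Z; rewrite !inE -!andbA [(#|_| == 1) && _]andbC.
rewrite (_ : (2 * e).+1 - e = e.+1); last by lia.
move=> H.
have : e.+1 * (#|[set Z in shell (2 * e).+1 | (#|I :\: (X :\: Z)| == 1) && (J \subset Z :\: X)]| + e.+1)
  = e.+1 * (w - e).
  rewrite mulnDr mulnC; apply: H; first by move=> Z; rewrite inE => /andP[/shell_sub[]].
  by move=> K KX cK; apply: cover_in.
by move/eqP; rewrite eqn_pmul2l // => /eqP; lia.
Qed.

(** Among the blocks whose pairs contain (I, J0), two that share a further point a of
    X would satisfy |A1 /\ A2| + |B1 /\ B2| >= (e + 2) + e, too much for two codewords at
    distance at least 2e + 1. So their remaining e points in X are disjoint. *)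
Lemma packing (I J0 : {set T}) : I \subset X -> #|I| = e.+1 -> J0 \subset ~: X -> #|J0| = e ->
  e * #|[set Z in [set Z in shell (2 * e).+1 | I \subset X :\: Z] | J0 \subset Z :\: X]| <= w - e.+1.
Proof.
move=> IX cI JX cJ; set S := [set Z in _ | _].
have -> : w - e.+1 = #|X :\: I| by rewrite cardsDS // card_X cI.
rewrite mulnC -sum_nat_const.
rewrite (eq_bigr (fun Z : {set T} => #|[set a in X :\: I | a \in X :\: Z]|)); last first.
  move=> Z; rewrite !inE -!andbA => /and4P[ZC /eqP D IZ _].
  have -> : [set a in X :\: I | a \in X :\: Z] = (X :\: Z) :\: I.
    by apply/setP => a; rewrite !inE; case: (a \in X); rewrite ?andbF ?andbT // andbC.
  by rewrite cardsDS // D cI; lia.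
rewrite double_count -sum1_card; apply: leq_sum => a; rewrite inE => /andP[aI aX].
rewrite leqNgt; apply/negP => /card_gt1P[Z [Z' [ZS Z'S ne]]].
have split_mem (Y : {set T}) : Y \in [set y in S | a \in X :\: y] ->
    [/\ Y \in C, #|X :\: Y| = (2 * e).+1, a |: I \subset X :\: Y & J0 \subset Y :\: X].
  rewrite inE /S => /andP[]; rewrite inE => /andP[]; rewrite inE => /andP[/shell_in[YC D _] IY] JY aY.
  by split=> //; rewrite subUset sub1set aY.
have [ZC D IZ JZ] := split_mem _ ZS; have [Z'C D' IZ' JZ'] := split_mem _ Z'S.
have far : 2 * e < #|Z :\: Z'| by apply: (mindist Ct ZC Z'C); rewrite eq_sym.
have ZX : Z :\: X \subset ~: X by rewrite setDE subsetIr.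
have := swap_dist Z' (subsetDl X Z) ZX.
have -> : (X :\: (X :\: Z)) :|: (Z :\: X) = Z by rewrite setDDr setDv set0U setIC setID.
have cI' : #|a |: I| = e.+2 by rewrite cardsU1 aI cI.
have := subset_leq_card (_ : a |: I \subset (X :\: Z) :&: (X :\: Z')).
rewrite subsetI IZ IZ' cI' => /(_ isT) h1.
have := subset_leq_card (_ : J0 \subset (Z :\: X) :&: (Z' :\: X)).
rewrite subsetI JZ JZ' cJ => /(_ isT) h2.
by rewrite (card_out Ct XC ZC) D D'; move: far h1 h2; clear; lia.
Qed.

(** For every pair (a, b), the w-set X - (I + a) + (J + b) lies in the ball of a single
    codeword Z, which is one of the following: the block covering (I, J), if a or b
    belongs to it; a block covering (I, J) except for one point; or a codeword at distance
    2e + 2. The numbers of codewords of the first two kinds are known, and the equation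
    gives the number of those of the third kind. *)
Lemma pair_count (I J : {set T}) : I \subset X -> #|I| = e.+1 -> J \subset ~: X -> #|J| = e.+1 ->
  (w - (2 * e).+1) * (w' - (2 * e).+1) =
  e * e.+1 * ((w - (2 * e).+1) + (w' - (2 * e).+1)) +
  e.+1 * e.+1 * #|[set Z in shell (2 * e).+2 | (I \subset X :\: Z) && (J \subset Z :\: X)]|.
Proof.
move=> IX cI JX cJ; have [l1 l2] := shell_room.
set P := setX (X :\: I) (~: X :\: J).
set U := w - _; set V := w' - _.
have cP : #|P| = (w - e.+1) * (w' - e.+1).
  by rewrite cardsX !cardsDS // cI cJ card_X card_Xc.
pose i Z := #|I :\: (X :\: Z)|; pose j (Z : {set T}) := #|J :\: (Z :\: X)|.
pose near (ab : T * T) Z := #|X :\: Z| + i Z + j Z <= 2 * e + (ab.1 \in X :\: Z) + (ab.2 \in Z :\: X).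
have nearE ab : ab \in P -> #|[set Z in C | near ab Z]| = 1.
  case: ab => a b; rewrite !inE /= => /andP[/andP[aI aX] /andP[bJ bX]].
  have AX : a |: I \subset X by rewrite subUset sub1set aX.
  have BX : b |: J \subset ~: X by rewrite subUset sub1set inE bX.
  have cA : #|a |: I| = e.+2 by rewrite cardsU1 aI cI.
  have cB : #|b |: J| = e.+2 by rewrite cardsU1 bJ cJ.
  rewrite -[RHS](near_unique Ct XC AX BX) ?cA ?cB //; apply: eq_card => Z; rewrite !inE; congr (_ && _).
  have := card_add_defect (X :\: Z) aI; have := card_add_defect (Z :\: X) bJ.
  by rewrite /near /i /j /= cI cJ; clear; lia.
(* The block of (I, J) meets all pairs except those with both entries outside it. *)
have cPZ Z : Z \in C -> Z != X -> #|[set ab in P | near ab Z]| =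
    (Z \in [set Z in shell (2 * e).+1 | (I \subset X :\: Z) && (J \subset Z :\: X)]) * (#|P| - U * V)
  + (Z \in [set Z in shell (2 * e).+1 | (#|I :\: (X :\: Z)| == 1) && (J \subset Z :\: X)]) * (e * e.+1)
  + (Z \in [set Z in shell (2 * e).+1 | (I \subset X :\: Z) && (#|J :\: (Z :\: X)| == 1)]) * (e * e.+1)
  + (Z \in [set Z in shell (2 * e).+2 | (I \subset X :\: Z) && (J \subset Z :\: X)]) * (e.+1 * e.+1).
  move=> ZC ZX; have D := mindist Ct XC ZC ZX; have cO := card_out Ct XC ZC.
  rewrite !inE ZC /= -![I \subset _]setD_eq0 -![J \subset _]setD_eq0 -!cards_eq0 -/(i Z) -/(j Z).
  have -> : #|[set ab in P | near ab Z]| =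
    #|[set ab in P | #|X :\: Z| + i Z + j Z - 2 * e <= (ab.1 \in X :\: Z) + (ab.2 \in Z :\: X)]|.
    apply: eq_card => ab; rewrite /near !inE; congr (_ && _); clear -D; lia.
  have rest (K A W : {set T}) : K \subset W -> A \subset W ->
      #|(W :\: K) :&: A| + #|K| = #|A| + #|K :\: A|.
    move=> KW AW; have -> : (W :\: K) :&: A = A :\: K by rewrite setIDAC (setIidPr AW).
    by have := cardsID A K; have := cardsID K A; rewrite [K :&: A]setIC; clear; lia.
  have out (K A W : {set T}) : K \subset W -> A \subset W -> #|K :\: A| = 0 ->
      #|(W :\: K) :\: A| = #|W| - #|A|.
    move=> KW AW /eqP; rewrite cards_eq0 setD_eq0 => KA.
    by rewrite setDDl (setUidPr KA) cardsDS.
  have AX : X :\: Z \subset X := subsetDl _ _.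
  have BX : Z :\: X \subset ~: X by rewrite setDE subsetIr.
  have ri := rest I _ X IX AX; have rj := rest J _ (~: X) JX BX.
  have oi := out I _ X IX AX; have oj := out J _ (~: X) JX BX.
  rewrite -/(i Z) card_X cI in ri oi; rewrite -/(j Z) card_Xc cJ cO in rj oj.
  rewrite card_rect; last by clear -D; lia.
  have -> : #|X :\: I| * #|~: X :\: J| = #|P| by rewrite cardsX.
  rewrite cP /U /V.
  apply: rect_cases => // d1 i0 j0.
  by rewrite oi // oj // d1.
have := double_count P C near.
rewrite (eq_bigr (fun=> 1)) ?sum1_card //.
rewrite (bigD1 X) //= (_ : [set ab in P | near ab X] = set0) ?cards0 ?add0n; last first.
  apply/setP => ab; rewrite !inE /near /i /j setDv !setD0 cI cJ !inE cards0; lia.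
rewrite (eq_bigr _ (fun Z H => cPZ Z (andP H).1 (andP H).2)).
have sumS d (Q : pred {set T}) c : 0 < d ->
    \sum_(Z in C | Z != X) (Z \in [set Z in shell d | Q Z]) * c = #|[set Z in shell d | Q Z]| * c.
  move=> d0; rewrite -big_distrl -sum1_card /=; congr (_ * c).
  rewrite big_mkcond [RHS]big_mkcond /=; apply: eq_bigr => Z _.
  rewrite !inE; case: (Z \in C) => //=; case: eqP => [->|_] /=; last by case: (_ && _).
  by rewrite setDv cards0 (ltn_eqF d0).
rewrite !big_split /= !sumS // cover_unique // defect_in // defect_out // mul1n.
have UVP : U * V <= #|P| by rewrite cP leq_mul // /U /V; lia.
rewrite -/U -/V; move: UVP; clearbody U V P; set p := #|[set Z in shell _ | _]|.
move: #|P| => m UVm E.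
have {E} -> : U * V = U * (e * e.+1) + V * (e * e.+1) + p * (e.+1 * e.+1) by move: E UVm; clear; lia.
by rewrite mulnDr ![e * e.+1 * _]mulnC [e.+1 * e.+1 * _]mulnC.
Qed.

Lemma mul2_bin2 m : 2 * 'C(m.+1, 2) = m.+1 * m.
Proof. by rewrite -mul_bin_diag bin1. Qed.

Lemma dvdn_of_pair_count u c2 x : u = e.+1 * x -> c2 * 'C(e.+2, 2) = 'C(u.+1, 2) ->
  e.+2 %| x * (e.+1 * x + 1).
Proof.
move=> -> E; apply/dvdnP; exists c2; apply/eqP; rewrite -(@eqn_pmul2l e.+1) //.
have := mul2_bin2 (e.+1 * x); rewrite -E mulnCA mul2_bin2; lia.
Qed.

Hypothesis e0 : 0 < e.

(** Here x + 1 and y + 1 are the numbers of blocks through a pair of sets of sizes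
    (e, e+1) and (e+1, e). The codewords at distance 2e + 2 covering a fixed
    (e+1)-set J form a design of (2e+2)-sets in which each (e+1)-set is in M blocks,
    whence the divisibility of M (x + 1), and of M (y + 1) by symmetry. *)
Lemma local_params : exists x y M,
  [/\ w = e + e.+1 * x.+1, w' = e + e.+1 * y.+1,
      x * y = e * (x + y) + M & e * y.+1 < e.+1 * x.+1] /\
  [/\ e.+2 %| x.+1 * (e.+1 * x.+1 + 1), e.+2 %| y.+1 * (e.+1 * y.+1 + 1),
      e.+2 %| M * x.+1 & e.+2 %| M * y.+1].
Proof.
have b1 : (2 * e).+1 - e = e.+1 by clear -e0; lia.
have b2 : (2 * e).+1 - e.-1 = e.+2 by clear -e0; lia.
have b3 : e.+1 - e.-1 = 2 by clear -e0; lia.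
have b4 v : e < v -> v - e.-1 = (v - e).+1 by clear -e0; lia.
have le0 : e <= e.+1 by clear -e0; lia.
have le1 : e.-1 <= e.+1 by clear -e0; lia.
have [I IX cI] : exists2 I : {set T}, I \subset X & #|I| = e.+1.
  by apply: sub_of_card; rewrite card_X.
have [J JX cJ] : exists2 J : {set T}, J \subset ~: X & #|J| = e.+1.
  by apply: sub_of_card; rewrite card_Xc.
have [I0 I0I cI0] : exists2 I0 : {set T}, I0 \subset I & #|I0| = e.
  by apply: sub_of_card; rewrite cI.
have [J0 J0J cJ0] : exists2 J0 : {set T}, J0 \subset J & #|J0| = e.
  by apply: sub_of_card; rewrite cJ.
have [I1 I1I cI1] : exists2 I1 : {set T}, I1 \subset I & #|I1| = e.-1.
  by apply: sub_of_card; rewrite cI.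
have [J1 J1J cJ1] : exists2 J1 : {set T}, J1 \subset J & #|J1| = e.-1.
  by apply: sub_of_card; rewrite cJ.
have I0X := subset_trans I0I IX; have I1X := subset_trans I1I IX.
have J0X := subset_trans J0J JX; have J1X := subset_trans J1J JX.
(* x counts the blocks through (I0, J), and y below those through (I, J0). *)
have [x Ex] : exists x, w - e = e.+1 * x.
  have := count_in JX cJ I0X; rewrite cI0 subSnn b1 !bin1 => /(_ le0) <-.
  by rewrite mulnC; eexists.
have Dx : e.+2 %| x * (e.+1 * x + 1).
  have := count_in JX cJ I1X; rewrite cI1 b2 b3 b4 // => /(_ le1); exact: dvdn_of_pair_count.
have [y Ey Ry] : exists2 y, w' - e = e.+1 * y & e * y <= w - e.+1.
  have := packing IX cI J0X; have := count_out IX cI J0X.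
  rewrite cJ0 subSnn b1 !bin1 => /(_ le0) <- /(_ erefl) R.
  by eexists; [exact: mulnC | exact: R].
have Dy : e.+2 %| y * (e.+1 * y + 1).
  have := count_out IX cI J1X; rewrite cJ1 b2 b3 b4 // => /(_ le1); exact: dvdn_of_pair_count.
have [l1 l2] := shell_room.
have x0 : 0 < x by case: x Ex {Dx} => // Ex; move: Ex ew; clear; lia.
have y0 : 0 < y by case: y Ey {Dy Ry} => // Ey; move: Ey ew'; clear; lia.
set M := #|[set Z in shell (2 * e).+2 | (I \subset X :\: Z) && (J \subset Z :\: X)]|.
have cM (K L : {set T}) : K \subset X -> #|K| = e.+1 -> L \subset ~: X -> #|L| = e.+1 ->
  #|[set Z in shell (2 * e).+2 | (K \subset X :\: Z) && (L \subset Z :\: X)]| = M.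
  move=> KX cK LX cL; have := pair_count KX cK LX cL; rewrite (pair_count IX cI JX cJ) -/M.
  by move/addnI/eqP; rewrite eqn_pmul2l // => /eqP.
have EM : x.-1 * y.-1 = e * (x.-1 + y.-1) + M.
  have := pair_count IX cI JX cJ; rewrite -/M.
  have -> : w - (2 * e).+1 = e.+1 * x.-1 by rewrite -subn1 mulnBr -Ex; clear; lia.
  have -> : w' - (2 * e).+1 = e.+1 * y.-1 by rewrite -subn1 mulnBr -Ey; clear; lia.
  move=> E; apply/eqP; rewrite -(@eqn_pmul2l (e.+1 * e.+1)) //; move: E; clear; lia.
have cop z : e.+2 %| M * (e.+1 * z) -> e.+2 %| M * z.
  by rewrite mulnCA Gauss_dvdr // coprimeSn.
have b5 : (2 * e).+2 - e = e.+2 by clear; lia.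
have Mx : e.+2 %| M * x.
  apply: cop; rewrite -Ex.
  have := @design_count _ _ [set Z in shell (2 * e).+2 | J \subset Z :\: X]
     (fun Z : {set T} => X :\: Z) X I0 (2 * e).+2 e.+1 M _ _ I0X.
  rewrite cI0 subSnn b5 !bin1 card_X => H; rewrite -H //; first exact: dvdn_mull.
    by move=> Z; rewrite inE => /andP[/shell_sub[]].
  move=> K KX cK; rewrite -(cM K J KX cK JX cJ); apply: eq_card => Z.
  by rewrite !inE -!andbA [(K \subset _) && _]andbC.
have My : e.+2 %| M * y.
  apply: cop; rewrite -Ey.
  have := @design_count _ _ [set Z in shell (2 * e).+2 | I \subset X :\: Z]
     (fun Z : {set T} => Z :\: X) (~: X) J0 (2 * e).+2 e.+1 M _ _ J0X.
  rewrite cJ0 subSnn b5 !bin1 card_Xc => H; rewrite -H //; first exact: dvdn_mull.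
    by move=> Z; rewrite inE => /andP[/shell_sub[]].
  move=> K KX cK; rewrite -(cM I K IX cI KX cK); apply: eq_card => Z.
  by rewrite !inE -!andbA.
case: x y x0 y0 Ex Ey Dx Dy Ry EM Mx My => [//|x] [//|y] _ _ Ex Ey Dx Dy Ry EM Mx My.
exists x, y, M; split; split=> //; move: Ex Ey Ry ew ew'; clear; lia.
Qed.
End Local.

(** * Lloyd numbers *)

(** The coefficient of z^j in (1 - z)^a * sum_k C(p, k) C(q, k) z^k. For p = w - m,
    q = w' - m and a = m - 1, it is the eigenvalue of the ball of radius j on the m-th
    harmonic space of the Johnson scheme, that is the value at m of the Lloyd polynomial. *)
Fixpoint lloyd (p q a j : nat) : int :=
  match a with
  | 0 => ('C(p, j) * 'C(q, j))%N%:Z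
  | a'.+1 => if j is j'.+1 then (lloyd p q a' j - lloyd p q a' j')%R else lloyd p q a' 0
  end.

(** Iterated differences with the sign T k - T (k + 1), for which the differences of
    [avoid_size] are exactly the values of [lloyd]. *)
Fixpoint nabla (a : nat) (T : nat -> int) (k : nat) : int :=
  if a is a'.+1 then (nabla a' T k - nabla a' T k.+1)%R else T k.

Lemma eq_nabla a T U k :
  (forall i, i <= a -> T (k + i) = U (k + i)) -> nabla a T k = nabla a U k.
Proof.
elim: a k => [|a IH] k E /=; first by have := E 0 isT; rewrite addn0.
rewrite (IH k) ?(IH k.+1) // => i le_i; last by apply: E; rewrite leqW.
by rewrite addSnnS; apply: E.
Qed.

Lemma nablaB a (T U : nat -> int) k :
  nabla a (fun i => T i - U i)%R k = (nabla a T k - nabla a U k)%R.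
Proof. by elim: a k => //= a IH k; rewrite !IH; lia. Qed.

Lemma nablaS a (T : nat -> int) k :
  nabla a.+1 T k = nabla a (fun i => T i - T i.+1)%R k.
Proof. by elim: a k => //= a IH k; rewrite -!IH /=. Qed.

(** The Gregory-Newton expansion of T at 0, proved at any base point j by induction on k. *)
Lemma newton (T : nat -> int) k N : k <= N ->
  T k = (\sum_(i < N.+1) (-1) ^+ i * ('C(k, i))%:Z * nabla i T 0)%R.
Proof.
have H j : k <= N -> T (k + j) = (\sum_(i < N.+1) (-1) ^+ i * ('C(k, i))%:Z * nabla i T j)%R.
  elim: k j => [|k IH] j kN.
    rewrite big_ord_recl /= bin0 expr0 !mul1r big1 ?addr0 // => i _.
    by rewrite bin0n /= mulr0 mul0r.
  rewrite addSnnS IH; last exact: ltnW.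
  transitivity (\sum_(i < N.+1) ((-1) ^+ i * ('C(k, i))%:Z * nabla i T j
      + (-1) ^+ i.+1 * ('C(k, i))%:Z * nabla i.+1 T j))%R.
    by apply: eq_bigr => i _ /=; rewrite exprS; ring.
  rewrite big_split /= [X in (X + _)%R]big_ord_recl [X in (_ + X)%R]big_ord_recr /=.
  rewrite (bin_small kN) mulr0 mul0r addr0 [RHS]big_ord_recl /= !bin0 -addrA -big_split.
  congr (_ + _)%R; apply: eq_bigr => i _; rewrite /bump /= add1n binS PoszD /=; ring.
by move=> kN; have := H 0 kN; rewrite addn0.
Qed.

(** Multiplication by 1 - z changes the ratio of consecutive coefficients in a
    controlled way: if g_(j-1) <= r g_j, then the new coefficients satisfy the same with
    r / (1 - r). Starting from r = s / t with s = e^2, the ratio after a steps is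
    s / (t - a s), and the coefficients stay positive as long as a s < t. *)
Lemma lloyd_pos p q a j e :
  e <= p -> e <= q -> j <= e -> a * e ^ 2 < (p - e).+1 * (q - e).+1 ->
  (0 < lloyd p q a j)%R.
Proof.
move=> ep eq.
set s := e ^ 2; set t := ((p - e).+1 * (q - e).+1)%N.
have base i : i < e -> t * ('C(p, i) * 'C(q, i)) <= s * ('C(p, i.+1) * 'C(q, i.+1)).
  move=> ie.
  have E1 := mul_bin_left p i; have E2 := mul_bin_left q i.
  apply: (@leq_trans ((p - i) * 'C(p, i) * ((q - i) * 'C(q, i)))).
    rewrite mulnACA; apply: leq_mul => //; apply: leq_mul; lia.
  rewrite -E1 -E2 mulnACA leq_mul2r; apply/orP; right.
  rewrite /s expnS expn1; exact: leq_mul.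
have main : forall b, b * s < t ->
   (forall i, i <= e -> (0 <= lloyd p q b i)%R) /\
   (forall i, i < e -> ((t%:Z - b%:Z * s%:Z) * lloyd p q b i <= s%:Z * lloyd p q b i.+1)%R).
  elim=> [|b IH] bs.
    split=> i ie /=; first by [].
    by have := base i ie; lia.
  have bs' : b * s < t by lia.
  have [I1 I2] := IH bs'.
  have R i : i < e -> ((t%:Z - b.+1%:Z * s%:Z) * lloyd p q b i <= s%:Z * lloyd p q b.+1 i.+1)%R.
    by move=> ie; have := I2 i ie; rewrite /=; lia.
  have Le i : i <= e -> (lloyd p q b.+1 i <= lloyd p q b i)%R.
    case: i => [|i] ie //=; have := I1 i (ltnW ie); lia.
  have tp : (0 < t%:Z - b.+1%:Z * s%:Z)%R by lia.
  split=> i ie.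
    case: i ie => [|i] ie; first exact: I1.
    have := R i ie; have := I1 i (ltnW ie) => H0 H1.
    have sp : (0 < s%:Z)%R by rewrite /s; nia.
    rewrite -(pmulr_rge0 _ sp); apply: le_trans H1; apply: mulr_ge0 => //; exact: ltW.
  apply: le_trans (R i ie); rewrite ler_wpM2l //; [exact: ltW | exact: Le (ltnW ie)].
move=> je at_; elim: j je => [|j IH] je.
  by elim: (a) => //=; rewrite !bin0.
have [_ /(_ j je)] := main a at_; have := IH (ltnW je).
have tp : (0 < t%:Z - a%:Z * s%:Z)%R by lia.
move=> H0 H1.
have sp : (0 < s%:Z)%R by rewrite /s; nia.
rewrite -(pmulr_rgt0 _ sp); apply: lt_le_trans H1; exact: mulr_gt0.
Qed.

(** Pascal's rule applied to both factors: a difference step lowers the upper index of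
    the first one and produces the recursion of [lloyd]. *)
Lemma nabla_lloyd p q a j : 0 < p -> j <= p ->
  nabla a (fun k => Posz ('C(p + a - k, p + a - j) * 'C(q + k, j))) 0 = lloyd p q a j.
Proof.
move=> p0; elim: a j => [|a IH] j jp.
  by rewrite /= !addn0 subn0 bin_sub.
rewrite nablaS.
have L i : i <= p -> lloyd p q a i =
   nabla a (fun k => Posz ('C((p + a.+1 - k).-1, (p + a.+1 - i).-1) * 'C(q + k, i))) 0.
  move=> ip; rewrite -IH //; apply: eq_nabla => k ka; rewrite add0n.
  by congr (Posz (binomial _ _ * _)); lia.
case: j jp => [|j] jp /=.
  rewrite L //; apply: eq_nabla => k ka; rewrite add0n !bin0 !muln1 subn0.
  rewrite (@bin_small (p + a.+1 - k.+1)) ?subr0; last by lia.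
  rewrite (_ : p + a.+1 - k = (p + a - k).+1); last by lia.
  by rewrite addnS /= binS bin_small //; lia.
rewrite (L j.+1) // (L j) 1?ltnW // -nablaB; apply: eq_nabla => k ka; rewrite add0n.
rewrite (_ : p + a.+1 - k.+1 = p + a - k); last by lia.
rewrite (_ : p + a.+1 - k = (p + a - k).+1); last by lia.
rewrite (_ : p + a.+1 - j.+1 = p + a - j); last by lia.
rewrite (_ : p + a.+1 - j = (p + a - j).+1); last by lia.
rewrite addnS !binS /=.
rewrite (_ : p + a - j = (p + a - j.+1).+1) /=; last by lia.
rewrite binS; lia.
Qed.

(** * The strength of a perfect code *)

(** For a w-set Z meeting an m-set I in k points, and q = w' - m, the number of w-sets
    disjoint from I within distance e of Z ([card_ball_avoid]). *)
Definition avoid_size (w q e k : nat) := \sum_(d < e.+1) 'C(w - k, w - d) * 'C(q + k, d).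

(** The sum telescopes after Pascal's rule on both factors. *)
Lemma avoid_size_diff w q e z : e < w ->
  \sum_(d < e.+1) 'C(z.+1, w - d) * 'C(q, d) =
  \sum_(d < e.+1) 'C(z, w - d) * 'C(q.+1, d) + 'C(z, w - e.+1) * 'C(q, e).
Proof.
elim: e => [|e IH] ew.
  rewrite !big_ord_recr !big_ord0 /= !add0n !bin0 !muln1 subn0 subn1.
  by case: w ew => // w _; rewrite binS.
rewrite big_ord_recr /= IH 1?ltnW // [in RHS]big_ord_recr /=.
have [m Em] : exists m, w - e.+1 = m.+1 by exists (w - e.+2); lia.
have -> : w - e.+2 = m by lia.
by rewrite Em !binS; lia.
Qed.

Lemma nabla_avoid_size w q e m : e + m <= w -> 0 < m < w ->
  nabla m (fun k => Posz (avoid_size w q e k)) 0 = lloyd (w - m) q m.-1 e.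
Proof.
case: m => // a ea /andP[_ aw]; rewrite -[a.+1.-1]/a.
rewrite nablaS -nabla_lloyd; [|lia|lia].
apply: eq_nabla => k ka; rewrite add0n /avoid_size.
have -> : w - k = (w - k.+1).+1 by lia.
rewrite avoid_size_diff; last by lia.
rewrite addnS PoszD addrAC subrr add0r.
by congr (Posz (binomial _ _ * _)); lia.
Qed.

Lemma sum_eq_le n e : \sum_(d < e.+1) (n == d :> nat) = (n <= e).
Proof.
elim: e => [|e IH]; first by rewrite big_ord_recl big_ord0 addn0 /=; case: n.
by rewrite big_ord_recr /= IH; lia.
Qed.

Lemma card_ball_avoid (T : finType) (w w' e : nat) (Z I : {set T}) :
  #|T| = w + w' -> #|Z| = w -> #|I| <= w' -> e <= w ->
  #|[set Y : {set T} | [&& #|Y| == w, [disjoint Y & I] & #|Y :\: Z| <= e]]| =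
  avoid_size w (w' - #|I|) e #|Z :&: I|.
Proof.
move=> cT cZ cI ew.
set U := Z :\: I; set V := ~: (Z :|: I).
have UV : U :|: V = ~: I.
  by apply/setP => x; rewrite !inE; case: (x \in Z); case: (x \in I).
have dUV : [disjoint U & V].
  by rewrite -setI_eq0; apply/eqP/setP => x; rewrite !inE; case: (x \in Z); rewrite ?andbF.
have cU : #|U| = w - #|Z :&: I| by rewrite cardsD cZ.
have cV : #|V| = w' - #|I| + #|Z :&: I|.
  rewrite /V cardsCs setCK cardsU cT cZ; move: cI.
  have := subset_leq_card (subsetIl Z I); have := subset_leq_card (subsetIr Z I).
  by rewrite cZ; clear; lia.
transitivity (\sum_(d < e.+1)
    #|[set Y : {set T} | [&& Y \subset U :|: V, #|Y :&: U| == w - d & #|Y :&: V| == d]]|); last first.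
  by apply: eq_bigr => d _; rewrite card_split // cU cV.
have cardE (P : pred {set T}) : #|[set Y | P Y]| = \sum_Y (P Y : nat).
  by rewrite -sum1dep_card big_mkcond; apply: eq_bigr => Y _; case: (P Y).
rewrite cardE (eq_bigr _ (fun (d : 'I_e.+1) _ => cardE (fun Y =>
  [&& Y \subset U :|: V, #|Y :&: U| == w - d & #|Y :&: V| == d]))) exchange_big /=.
apply: eq_bigr => Y _; rewrite UV -disjoints_subset.
case dYI: [disjoint Y & I]; last by rewrite andbF big1.
have YV : Y :&: V = Y :\: Z.
  apply/setP => x; rewrite !inE; case xY: (x \in Y) => //=; last by rewrite andbF.
  by rewrite (disjointFr dYI xY) orbF andbT.
have YU : Y :&: U = Y :&: Z.
  by apply/setP => x; rewrite !inE; case xY: (x \in Y) => //=; rewrite (disjointFr dYI xY).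
rewrite YV YU -(cardsID Z Y) /=.
rewrite (eq_bigr (fun d : 'I_e.+1 => (#|Y :&: Z| + #|Y :\: Z| == w) * (#|Y :\: Z| == d))).
  by rewrite -big_distrr sum_eq_le; case: (_ == w); case: (_ <= e).
move=> [d de] _ /=; have dw : d <= w by rewrite (leq_trans _ ew).
move: #|Y :&: Z| #|Y :\: Z| => al be; case: (altP (be =P d)) => [->|_]; rewrite ?andbF ?muln0 //.
by rewrite andbT muln1 -{2}(subnK dw) eqn_add2r.
Qed.

Section Strength.
Local Open Scope ring_scope.

(** Induction on |I|. Summing the ball equations over all Y disjoint from I gives
    sum_Z F(Z) A(|Z /\ I|) = 0 with A an explicit function. Newton's formula writes A as a
    combination of the C(|Z /\ I|, i), and the sum of F(Z) C(|Z /\ I|, i) is the sum of the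
    star sums of F at the i-subsets of I. All of them vanish by induction except that of I
    itself, whose coefficient is a Lloyd number up to sign, or the size of a ball if I is
    empty. *)
Lemma ball_null_star (T : finType) (w w' e t : nat) (F : {set T} -> int) :
  (#|T| = w + w')%N -> (e + t <= w)%N -> (t < w)%N -> (t <= w')%N ->
  (forall Y : {set T}, #|Y| = w -> \sum_(Z : {set T} | (#|Z| == w) && (#|Y :\: Z| <= e)%N) F Z = 0) ->
  (forall m, (0 < m <= t)%N -> lloyd (w - m) (w' - m) m.-1 e != 0) ->
  forall I : {set T}, (#|I| <= t)%N -> \sum_(Z : {set T} | (#|Z| == w) && (I \subset Z)) F Z = 0.
Proof.
move=> cT etw tw tw' Fball Lnz I.
have [m] := ubnP #|I|; elim: m I => // m IH I; rewrite ltnS => Im It.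
have {}IH (J : {set T}) : J \subset I -> J != I -> \sum_(Z : {set T} | (#|Z| == w) && (J \subset Z)) F Z = 0.
  move=> JI ne; have lt : (#|J| < #|I|)%N by apply: proper_card; rewrite properEneq ne.
  by apply: IH; [apply: leq_trans lt Im | apply: leq_trans (ltnW lt) It].
set A := avoid_size w (w' - #|I|) e.
have H0 : \sum_(Z : {set T} | #|Z| == w) F Z * (A #|Z :&: I|)%:Z = 0.
  transitivity (\sum_(Y : {set T} | (#|Y| == w) && [disjoint Y & I])
      \sum_(Z : {set T} | (#|Z| == w) && (#|Y :\: Z| <= e)%N) F Z); last first.
    by apply: big1 => Y /andP[/eqP cY _]; apply: Fball.
  rewrite (exchange_big_dep (fun Z : {set T} => #|Z| == w)) /=; last by move=> Y Z _ /andP[].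
  apply: eq_bigr => Z /eqP cZ.
  rewrite /A -(card_ball_avoid cT cZ) ?(leq_trans It) //; last by lia.
  rewrite -natz mulr_natr -sumr_const; apply: eq_bigl => Y.
  by rewrite inE cZ eqxx andbA.
have H1 : \sum_(i < #|I|.+1) (-1) ^+ i * nabla i (fun k => (A k)%:Z) 0 *
   (\sum_(Z : {set T} | #|Z| == w) F Z * 'C(#|Z :&: I|, i)%:Z) = 0.
  rewrite -[RHS]H0; under [RHS]eq_bigr => Z _.
    rewrite (newton (fun k => (A k)%:Z) (N := #|I|)); last exact: subset_leq_card (subsetIr _ _).
    rewrite big_distrr /=.
    over.
  rewrite [RHS]exchange_big /=; apply: eq_bigr => i _; rewrite big_distrr /=.
  by apply: eq_bigr => Z _; ring.
have stars i : \sum_(Z : {set T} | #|Z| == w) F Z * 'C(#|Z :&: I|, i)%:Z =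
   \sum_(J : {set T} | (J \subset I) && (#|J| == i)) \sum_(Z : {set T} | (#|Z| == w) && (J \subset Z)) F Z.
  rewrite (exchange_big_dep (fun Z : {set T} => #|Z| == w)) /=; last by move=> J Z _ /andP[].
  apply: eq_bigr => Z cZ; rewrite -cards_draws -natz mulr_natr -sumr_const; apply: eq_bigl => J.
  by rewrite !inE cZ subsetI /= [(J \subset Z) && _]andbC andbAC.
rewrite big_ord_recr /= big1 ?add0r in H1; last first.
  move=> [i iI] _ /=; rewrite stars big1 ?mulr0 // => J /andP[JI /eqP cJ].
  by apply: IH => //; apply: contraTneq iI => E; rewrite -cJ E ltnn.
have one : \sum_(J : {set T} | (J \subset I) && (#|J| == #|I|)) \sum_(Z : {set T} | (#|Z| == w) && (J \subset Z)) F Z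
   = \sum_(Z : {set T} | (#|Z| == w) && (I \subset Z)) F Z.
  rewrite (big_pred1 I) // => J /=; rewrite eqEcard; case JI: (J \subset I) => //=.
  by rewrite eqn_leq subset_leq_card.
move/eqP: H1; rewrite stars one !mulf_eq0 signr_eq0 /= => /orP[|/eqP//].
case: (posnP #|I|) => [I0|Ipos]; last first.
  rewrite nabla_avoid_size; last by lia.
    by have := Lnz #|I|; rewrite Ipos It => /(_ isT)/negbTE->.
  lia.
rewrite I0 /= /A /avoid_size (bigD1 ord0) //= subn0 binn bin0 mul1n add1n; lia.
Qed.

End Strength.

Lemma card_ball (T : finType) (w w' e : nat) (Y : {set T}) :
  #|T| = w + w' -> #|Y| = w -> e <= w ->
  #|[set Z : {set T} | (#|Z| == w) && (#|Y :\: Z| <= e)]| = ball_size w w' e.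
Proof.
move=> cT cY ew; have := @card_ball_avoid T w w' e Y set0 cT cY _ ew.
rewrite cards0 subn0 => /(_ isT); rewrite setI0 cards0 /avoid_size /ball_size subn0 addn0 => E.
transitivity (\sum_(d < e.+1) 'C(w, w - d) * 'C(w', d)).
  rewrite -E; apply: eq_card => Z; rewrite !inE disjoint_sym disjoints_subset sub0set /=.
  by case: eqP => //= cZ; rewrite (@card_setD_sym _ Y Z) ?cZ.
rewrite big_mkord; apply: eq_bigr => -[d de] _ /=; rewrite bin_sub //.
exact: leq_trans (_ : d <= e) ew.
Qed.

(** [ball_null_star] for the function Phi 1_C - 1, where Phi is the size of a ball. *)
Lemma tiles_card_star (T : finType) (w w' e t : nat) (C : {set {set T}}) :
  #|T| = w + w' -> tiles w e C -> e + t <= w -> e + t <= w' -> t < w ->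
  (forall m, 0 < m <= t -> m.-1 * e ^ 2 < (w - m - e).+1 * (w' - m - e).+1) ->
  forall I : {set T}, #|I| <= t ->
  ball_size w w' e * #|[set X in C | I \subset X]| = 'C(w + w' - #|I|, w - #|I|).
Proof.
move=> cT [Cw Ct] etw etw' tw pos I It.
pose F (Z : {set T}) : int := (Posz (ball_size w w' e * (Z \in C)) - 1)%R.
have ew : e <= w by lia.
have sumF (P : pred {set T}) :
    (\sum_(Z : {set T} | P Z) F Z = Posz (ball_size w w' e * #|[set Z in C | P Z]|) - Posz #|[set Z | P Z]|)%R.
  rewrite sumrB -(big_morph Posz PoszD (erefl _)) -big_distrr /=; congr (Posz (_ * _) - _)%R.
    rewrite -sum1dep_card big_mkcond [RHS]big_mkcond /=; apply: eq_bigr => Z _.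
    by case: (Z \in C); case: (P Z).
  by rewrite -sum1dep_card (big_morph Posz PoszD (erefl _)).
have Fnull (Y : {set T}) : #|Y| = w ->
    (\sum_(Z : {set T} | (#|Z| == w) && (#|Y :\: Z| <= e)%N) F Z = 0)%R.
  move=> cY; rewrite sumF (card_ball cT cY ew) -[in RHS](subrr (Posz (ball_size w w' e))).
  congr (Posz _ - _)%R; rewrite -[RHS]muln1 -(Ct Y cY); congr (_ * _).
  by apply: eq_card => Z; rewrite !inE; case ZC: (Z \in C) => //=; rewrite Cw ?eqxx.
have := @ball_null_star T w w' e t F cT etw tw _ Fnull _ I It.
rewrite sumF => H.
have Iw : #|I| <= w by lia.
have := @card_between T I [set: T] w (subsetT I) Iw.
rewrite cardsT cT => <-.
have -> : [set K : {set T} | [&& I \subset K, K \subset [set: T] & #|K| == w]] =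
    [set Z : {set T} | (#|Z| == w) && (I \subset Z)].
  by apply/setP => K; rewrite !inE subsetT andbC.
have -> : [set X in C | I \subset X] = [set Z in C | (#|Z| == w) && (I \subset Z)].
  by apply/setP => Z; rewrite !inE; case ZC: (Z \in C) => //=; rewrite Cw ?eqxx.
apply/eqP; rewrite -eqz_nat -subr_eq0 H //; first by lia.
move=> m mt; apply/lt0r_neq0/(lloyd_pos (e := e)); try lia.
exact: pos.
Qed.

(** * Parameters of nontrivial perfect codes *)

(** If x < 2e then y <= x + 1, and x y >= e (x + y) fails unless x = y = 0. *)
Lemma size_dichotomy e x y M : 0 < e -> x <= y ->
  x * y = e * (x + y) + M -> e * y.+1 < e.+1 * x.+1 -> (x = 0 /\ y = 0) \/ 2 * e <= x.
Proof.
move=> e0 xy EM R; case: (leqP (2 * e) x) => H; [by right | left].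
have yx : y <= x.+1 by nia.
have [Ey|Ey] : y = x.+1 \/ y = x by lia.
  have := leq_mul (leqnn x) H; rewrite Ey in EM; lia.
subst y; case: (posnP x) => // x0.
have lt : x * x < x * (2 * e) by rewrite ltn_pmul2l.
by exfalso; move: EM lt; clear; lia.
Qed.

(** Modulo 8 the product is x (1 - x), and 0 and 1 are the only idempotents
    modulo a prime power. *)
Lemma idempotent_mod8 x f : 8 %| x * ((8 * f + 7) * x + 1) -> x %% 8 = 0 \/ x %% 8 = 1.
Proof.
move=> H.
have {H} : 8 %| x * (7 * x + 1).
  have E : x * ((8 * f + 7) * x + 1) = f * x * x * 8 + x * (7 * x + 1) by lia.
  by move: H; rewrite E dvdn_addr // dvdn_mull.
have E := divn_eq x 8; have := ltn_pmod x (isT : 0 < 8).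
move: (x %/ 8) (x %% 8) E => k r -> r8.
have -> : (k * 8 + r) * (7 * (k * 8 + r) + 1) =
   (k * (7 * (k * 8 + r) + 1) + r * 7 * k) * 8 + r * (7 * r + 1) by lia.
rewrite dvdn_addr; last exact: dvdn_mull.
by case: r r8 => [|[|[|[|[|[|[|[|r]]]]]]]] r8 H;
  first [by left | by right | by vm_compute in H].
Qed.

Lemma pow2_bounds w : 0 < w -> exists L, 2 ^ L <= w < 2 ^ L.+1.
Proof. by move=> w0; exists (trunc_log 2 w); apply: trunc_log_bounds. Qed.

(** In the second case the divisibilities by e + 2, a multiple of 8, force x + 1 and
    y + 1 to be 0 or 1 modulo 8. They are equal modulo 8: otherwise M = 6 modulo 8,
    while 8 divides M times a number that is 1 modulo 8. *)
Lemma dvd4_ball_size e w w' x y M :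
  e = 3 %[mod 4] \/ e = 6 %[mod 8] ->
  w = e + e.+1 * x.+1 -> w' = e + e.+1 * y.+1 ->
  x * y = e * (x + y) + M ->
  e.+2 %| x.+1 * (e.+1 * x.+1 + 1) -> e.+2 %| y.+1 * (e.+1 * y.+1 + 1) ->
  e.+2 %| M * x.+1 -> e.+2 %| M * y.+1 -> 4 %| ball_size w w' e.
Proof.
case=> E Ew Ew' EM dx dy dMx dMy.
  have [f Ef] : exists f, e = 4 * f + 3 by exists (e %/ 4); lia.
  have -> : w = 4 * (f + f.+1 * x.+1) + 3 by rewrite Ew Ef; lia.
  have -> : w' = 4 * (f + f.+1 * y.+1) + 3 by rewrite Ew' Ef; lia.
  by rewrite Ef; apply: dvd4_ball_size3.
have [f Ef] : exists f, e = 8 * f + 6 by exists (e %/ 8); lia.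
have e2 : e.+2 = 8 * f.+1 by lia.
have e1 : e.+1 = 8 * f + 7 by lia.
have d8 m : e.+2 %| m -> 8 %| m by apply: dvdn_trans; rewrite e2 dvdn_mulr.
have res z v : v = e + e.+1 * z -> exists V, v = 8 * V + 6 + 7 * (z %% 8).
  move=> ->; exists (f + f * z + 7 * (z %/ 8)).
  by rewrite e1 Ef {1 2}(divn_eq z 8); lia.
have [W EW] := res _ _ Ew; have [W' EW'] := res _ _ Ew'.
(* Modulo 8, a = 0, b = 7 and e = 6, so that M = a b - e (a + b) = 6. *)
have mixed : forall a b, a * b = e * (a + b) + M -> a.+1 %% 8 = 1 -> b.+1 %% 8 = 0 -> ~ (8 %| M * a.+1).
  move=> a b Eab a1 b0.
  have [k Ek] : exists k, a = 8 * k by exists (a %/ 8); lia.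
  have [l El] : exists l, b = 8 * l + 7 by exists (b %/ 8); lia.
  move=> /dvdnP[q Eq]; move: Eab; rewrite Ef Ek El.
  have -> : M = 8 * (q - k * M) by move: Eq; rewrite Ek; lia.
  move: (q - k * M) => r; move: (k * l) (f * k) (f * l) => *; lia.
have [x0|x1] := idempotent_mod8 (eq_ind _ (fun u => 8 %| x.+1 * (u * x.+1 + 1)) (d8 _ dx) _ e1);
have [y0|y1] := idempotent_mod8 (eq_ind _ (fun u => 8 %| y.+1 * (u * y.+1 + 1)) (d8 _ dy) _ e1).
- by rewrite EW EW' Ef x0 y0 !muln0 !addn0; apply: dvd4_ball_size6.
- by case: (mixed y x) => //; [rewrite mulnC EM addnC [_ + y]addnC; lia | exact: d8].
- by case: (mixed x y) => //; exact: d8.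
rewrite EW EW' Ef x1 y1 !muln1.
have R V : 8 * V + 6 + 7 = 8 * V.+1 + 5 by lia.
by rewrite !R; apply: dvd4_ball_size5.
Qed.

(** The contradiction sought when w > 2e + 1: for t = w - 2^L, the number of codewords
    through a t-set times the size of a ball is C(2^L + w', 2^L). *)
Lemma tiles_params_le (T : finType) (w w' e : nat) (C : {set {set T}}) (X : {set T}) :
  #|T| = w + w' -> tiles w e C -> X \in C -> e < w -> w <= w' ->
  [\/ e = 3 %[mod 8], e = 6 %[mod 8] | e = 7 %[mod 8]] ->
  w = (2 * e).+1 /\ w' = (2 * e).+1.
Proof.
move=> cT Ct XC ew ww' hmod.
have e3 : 3 <= e by case: hmod; lia.
have e0 : 0 < e by lia.
have [x [y [M [[Ew Ew' EM R] [dx dy dMx dMy]]]]] :=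
  local_params cT Ct XC ew (leq_trans ew ww') e0.
have xy : x <= y.
  by move: ww'; rewrite Ew Ew' leq_add2l leq_pmul2l.
have [[x0 y0]|xe] := size_dichotomy e0 xy EM R; first by rewrite Ew Ew' x0 y0; lia.
have d4 : 4 %| ball_size w w' e.
  apply: dvd4_ball_size Ew Ew' EM dx dy dMx dMy; case: hmod; lia.
have w_big : e.+1 ^ 2 * 2 <= w.+1.
  have : e.+1 * (2 * e) <= e.+1 * x by rewrite leq_mul2l xe orbT.
  by rewrite Ew; lia.
(* e >= 3 is used here: w' - w is about w / e at most. *)
have w'_small : 3 * w' <= 4 * w.
  have h : e * (w' - w) <= w.
    have r : e * (y - x) <= x by rewrite mulnBr; move: R; clear; lia.
    have -> : w' - w = e.+1 * (y - x) by rewrite Ew Ew' subnDl -mulnBr subSS.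
    have : e.+1 * (e * (y - x)) <= e.+1 * x by rewrite leq_mul2l r orbT.
    by rewrite mulnCA Ew; clear; lia.
  have : 3 * (w' - w) <= e * (w' - w) by rewrite leq_mul2r e3 orbT.
  by move: h ww'; clear; lia.
have [L /andP[Llo Lhi]] := pow2_bounds (leq_trans (ltn0Sn e) ew).
rewrite expnS in Lhi.
have [I _ cI] : exists2 I : {set T}, I \subset [set: T] & #|I| = w - 2 ^ L.
  by apply: sub_of_card; rewrite cardsT cT; clear; lia.
have eL : e <= 2 ^ L by move: w_big Lhi; clear; lia.
have L0 : 0 < 2 ^ L by rewrite expn_gt0.
have := @tiles_card_star T w w' e (w - 2 ^ L) C cT Ct _ _ _ _ I _.
rewrite cI => H.
have {H} : ball_size w w' e * #|[set X0 in C | I \subset X0]| = 'C(2 ^ L + w', 2 ^ L).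
  rewrite H //; first 1 [by congr binomial; move: Llo; clear; lia];
    try by move: Llo eL L0 ww'; clear; lia.
  move=> m /andP[m0 mt].
  (* m <= w - 2^L with 2^L > w / 2. *)
  have p_half : w.+1 <= 2 * (w - m) by move: Llo Lhi mt; clear; lia.
  have p_big : e.+1 ^ 2 <= w - m by move: w_big p_half; clear; lia.
  have mp : m.-1 < w - m by move: Llo Lhi mt m0; clear; lia.
  have qp : w - m <= w' - m by rewrite leq_sub2r.
  move: (w - m) (w' - m) m.-1 p_big mp qp; clear -e3 => p q a pb ap pq.
  have h1 : a * e ^ 2 <= p * e ^ 2 by rewrite leq_mul2r ltnW ?orbT.
  have h2 : (p - e) * (p - e) < (p - e).+1 * (q - e).+1 by apply: ltn_mul; lia.
  apply: leq_ltn_trans h1 (leq_ltn_trans _ h2).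
  have [k Ek] : exists k, p = e.+1 ^ 2 + k by exists (p - e.+1 ^ 2); lia.
  (* p = (e+1)^2 + k gives (p - e)^2 >= p (p - 2e) >= p e^2. *)
  have Epe : p - e = e ^ 2 + e + 1 + k by rewrite Ek -mulnn; lia.
  rewrite Epe Ek -!mulnn; lia.
move=> E; have := @bin_pow2_ndvd4 L (2 ^ L + w') _.
rewrite -E dvdn_mulr // => H; exfalso; suff: ~~ true by [].
apply: H.
by rewrite !expnS; move: w'_small Lhi; clear; lia.
Qed.

(** * Passing to complements and conclusion *)

Lemma tiles_compl (T : finType) (w w' e : nat) (C : {set {set T}}) :
  #|T| = w + w' -> tiles w e C -> tiles w' e [set ~: X | X in C].
Proof.
move=> cT [Cw Ct]; have cc (Y : {set T}) : #|~: Y| = w + w' - #|Y| by rewrite cardsCs setCK cT.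
split=> [_ /imsetP[X XC ->]|Y cY]; first by rewrite cc Cw // addKn.
have cY' : #|~: Y| = w by rewrite cc cY addnK.
rewrite -[RHS](Ct _ cY') -[RHS](card_imset _ (@setC_inj T)).
apply: eq_card => Z; rewrite -[Z]setCK; set X := ~: Z.
rewrite inE !mem_imset; try exact: setC_inj.
rewrite inE; case XC: (X \in C) => //=.
by rewrite (@card_setD_sym _ (~: Y) X) ?(Cw X XC) ?cY' // !setDE !setCK setIC.
Qed.

Lemma tiles_near_eq (T : finType) (w e : nat) (C : {set {set T}}) X Z :
  tiles w e C -> X \in C -> Z \in C -> #|X :\: Z| <= e -> X = Z.
Proof.
move=> Ct XC ZC le_; apply: (card1_eq (proj2 Ct X (proj1 Ct X XC))).
  by rewrite inE XC setDv cards0.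
by rewrite inE ZC.
Qed.

Lemma tiles_params (T : finType) (w w' e : nat) (C : {set {set T}}) (X Z : {set T}) :
  #|T| = w + w' -> tiles w e C -> X \in C -> Z \in C -> X != Z ->
  [\/ e = 3 %[mod 8], e = 6 %[mod 8] | e = 7 %[mod 8]] ->
  w = (2 * e).+1 /\ w' = (2 * e).+1.
Proof.
move=> cT Ct XC ZC ne hmod.
have cX := proj1 Ct _ XC; have cZ := proj1 Ct _ ZC.
have far : e < #|X :\: Z|.
  by rewrite ltnNge; apply: contra ne => le_; apply/eqP/(tiles_near_eq Ct).
have ew : e < w by apply: leq_trans far _; rewrite -cX subset_leq_card // subsetDl.
have ew' : e < w'.
  have <- : #|~: Z| = w' by rewrite cardsCs setCK cT cZ addKn.
  by apply: leq_trans far _; rewrite subset_leq_card // setDE subsetIr.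
case: (leqP w w') => [le_|lt]; first exact: (tiles_params_le cT Ct XC).
have cT' : #|T| = w' + w by rewrite addnC.
have [-> ->] // := tiles_params_le cT' (tiles_compl cT Ct) (imset_f _ XC) ew' (ltnW lt) hmod.
Qed.

Theorem corollary3p4 (e : nat) (he : 1 <= e)
    (hmod : [\/ e = 3 %[mod 8], e = 6 %[mod 8] | e = 7 %[mod 8]]) :
  forall n w : nat, 1 <= w <= n - 1 ->
    ~ exists C : {set {set 'I_n}}, perfect_code w e C /\ ~ trivial_code w e C.
Proof.
move=> n w hw [C [[Csub Cdisj Ccov] nontriv]].
have cT : #|'I_n| = w + (n - w) by rewrite card_ord; move: hw; clear; lia.
have Cw X : X \in C -> #|X| = w by move/(subsetP Csub); rewrite inE => /eqP.
have Ct : tiles w e C.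
  split=> // Y cY.
  have YJ : Y \in johnson n w by rewrite inE cY.
  move: (YJ); rewrite -Ccov => /bigcupP[X XC]; rewrite inE => /andP[_ dXY].
  have Ysym Z : Z \in C -> #|Y :\: Z| = johnson_dist Z Y.
    by move=> ZC; apply: card_setD_sym; rewrite cY Cw.
  apply/eqP/cards1P; exists X; apply/setP => Z; rewrite !inE.
  apply/andP/eqP => [[ZC dYZ]|->]; last by rewrite Ysym.
  apply/eqP; apply: contraT => ne; have /pred0P/(_ Y) := Cdisj _ _ ZC XC ne.
  by rewrite /= !inE cY eqxx dXY -Ysym // dYZ.
have [Y _ cY] : exists2 Y : {set 'I_n}, Y \subset [set: 'I_n] & #|Y| = w.
  by apply: sub_of_card; rewrite cardsT cT leq_addr.
have /card_gt0P[X] : 0 < #|[set Z in C | #|Y :\: Z| <= e]| by rewrite (proj2 Ct).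
rewrite inE => /andP[XC _].
have [/eqP CX|[Z ZC XZ]] : C == [set X] \/ exists2 Z, Z \in C & X != Z.
  case: (altP (C =P [set X])) => [|neC]; [by left | right].
  have : ~~ (C \subset [set X]) by apply: contra neC => CX; rewrite eqEsubset CX sub1set.
  by case/subsetPn => Z ZC; rewrite inE eq_sym; exists Z.
  by apply: nontriv; apply: Or32; rewrite CX cards1.
have [w1 w2] := tiles_params cT Ct XC ZC XZ hmod.
have opp V : V \in C -> V != X -> V = ~: X.
  move=> VC VX; have far := mindist Ct XC VC VX.
  have dVX : [disjoint V & X].
    rewrite -setI_eq0 -cards_eq0 setIC; have := cardsID V X; rewrite (Cw X XC) w1; move: far; clear; lia.
  apply/eqP; rewrite eqEcard -disjoints_subset dVX /= (Cw V VC).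
  by rewrite cardsCs setCK cT (Cw X XC) addKn w2 w1.
apply: nontriv; apply: Or33; split; [move: hw w1 w2; clear; lia | by rewrite addn1 |].
exists X; first exact: (subsetP Csub).
apply/setP => V; rewrite !inE; apply/idP/orP => [VC|[/eqP->//|/eqP->]].
  by case: (altP (V =P X)) => [_|VX]; [left | right; rewrite -(opp V VC VX)].
by rewrite -(opp Z ZC) // eq_sym.
Qed.
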